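(* There is an algorithm that, given a finite graph $G$, a pair of vertices $a,b \in V(G)$, and an integer $k$, enumerates (without repetition) exactly the minimal $a,b$-separators of $G$ that contain at most $k$ vertices, and that, for every $R$, outputs the first $R$ such minimal separators within $O^*(R \cdot \min(4^k, R))$ time.
   Context: Graphs are finite, simple and undirected. For vertices $a,b$ of $G$, a minimal $a,b$-separator is a vertex set $S \subseteq V(G)$ such that $a$ and $b$ lie in different connected components of $G \setminus S$ (the subgraph induced by $V(G)\setminus S$), and $S$ is inclusion-wise minimal with this property. The notation $O^*(\cdot)$ suppresses factors polynomial in the input size (the size of $G$). *)

(* Defs.v *)
From mathcomp Require Import all_boot all_order all_algebra.
Set Implicit Arguments.
Unset Strict Implicit.
Unset Printing Implicit Defensive.

Record sgraph (T : finType) := SGraph {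
  adj : rel T;
  adj_sym : symmetric adj;
  adj_irrefl : irreflexive adj
}.

Section Separators.
Variables (T : finType) (G : sgraph T).
Implicit Types (S : {set T}) (a b : T).

Definition adj_del S : rel T :=
  [rel x y | [&& x \notin S, y \notin S & adj G x y]].

Definition components_del S : {set {set T}} :=
  equivalence_partition (connect (adj_del S)) (~: S).

(* Vertices of S lie in no component, so S avoids a and b; in particular
   there is no separator when a = b or when a and b are adjacent. *)
Definition separates a b S : bool :=
  [exists A in components_del S, exists B in components_del S,
    [&& A != B, a \in A & b \in B]].

Definition min_separator a b S : bool := minset (separates a b) S.

End Separators.

(* The model of computation is a deterministic first-order call-by-value
   functional language over binary trees, in the style of Jones's languages
   WHILE and F, with a write-only output.  Each evaluation rule takes one unit
   of time.  Every rule is a constant number of pointer operations on shared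
   immutable cells (an environment has bounded length for a fixed program), so
   T units take O(T) operations on a pointer machine or a RAM; conversely T
   steps of a logarithmic-cost RAM take T * polylog(T) units.  For the times
   considered here, log T is polynomial in the size of the graph, so the
   choice of model is absorbed by the O^* notation. *)

Inductive tree := Nil | Cons of tree & tree.

(* Variables are de Bruijn indices and functions are named by their position
   in the program.  [ECase e e1 e2] is
     match e with Nil => e1 | Cons x y => e2 end
   where, in e2, x is variable 0 and y is variable 1.  [ELet e1 e2] binds
   variable 0 of e2.  The body of a function sees only its arguments. *)
Inductive expr :=
  | EVar of nat
  | ENil
  | ECons of expr & expr
  | ECase of expr & expr & expr
  | ELet of expr & expr
  | ECall of nat & seq expr
  | EOut of expr.

Definition program := seq expr.

(* [eval p env e t v t' o]: in program p, evaluation of e in env started at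
   time t yields v at time t', having output the items listed in o, each one
   paired with the time at which it was output. *)
Inductive eval (p : program) :
    seq tree -> expr -> nat -> tree -> nat -> seq (nat * tree) -> Prop :=
  | eval_var env i t :
      eval p env (EVar i) t (nth Nil env i) t.+1 [::]
  | eval_nil env t :
      eval p env ENil t Nil t.+1 [::]
  | eval_cons env e1 e2 t v1 t1 o1 v2 t2 o2 :
      eval p env e1 t.+1 v1 t1 o1 ->
      eval p env e2 t1 v2 t2 o2 ->
      eval p env (ECons e1 e2) t (Cons v1 v2) t2 (o1 ++ o2)
  | eval_case_nil env e e1 e2 t t0 o0 v1 t1 o1 :
      eval p env e t.+1 Nil t0 o0 ->
      eval p env e1 t0 v1 t1 o1 ->
      eval p env (ECase e e1 e2) t v1 t1 (o0 ++ o1)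
  | eval_case_cons env e e1 e2 t x y t0 o0 v2 t2 o2 :
      eval p env e t.+1 (Cons x y) t0 o0 ->
      eval p [:: x, y & env] e2 t0 v2 t2 o2 ->
      eval p env (ECase e e1 e2) t v2 t2 (o0 ++ o2)
  | eval_let env e1 e2 t v1 t1 o1 v2 t2 o2 :
      eval p env e1 t.+1 v1 t1 o1 ->
      eval p (v1 :: env) e2 t1 v2 t2 o2 ->
      eval p env (ELet e1 e2) t v2 t2 (o1 ++ o2)
  | eval_call env f es t vs t1 o1 v t2 o2 :
      evals p env es t.+1 vs t1 o1 ->
      eval p vs (nth ENil p f) t1 v t2 o2 ->
      eval p env (ECall f es) t v t2 (o1 ++ o2)
  | eval_out env e t v t1 o :
      eval p env e t.+1 v t1 o ->
      eval p env (EOut e) t Nil t1 (rcons o (t1, v))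
with evals (p : program) :
    seq tree -> seq expr -> nat -> seq tree -> nat -> seq (nat * tree) -> Prop :=
  | evals_nil env t :
      evals p env [::] t [::] t [::]
  | evals_cons env e es t v t1 o1 vs t2 o2 :
      eval p env e t v t1 o1 ->
      evals p env es t1 vs t2 o2 ->
      evals p env (e :: es) t (v :: vs) t2 (o1 ++ o2).

Scheme eval_mind := Minimality for eval Sort Prop
  with evals_mind := Minimality for evals Sort Prop.

Lemma eval_det p env e t v t' o v2 t2 o2 :
  eval p env e t v t' o -> eval p env e t v2 t2 o2 ->
  [/\ v2 = v, t2 = t' & o2 = o].
Proof.
move=> H; move: v2 t2 o2.
apply: (@eval_mind p
  (fun env e t v t' o => forall v2 t2 o2,
     eval p env e t v2 t2 o2 -> [/\ v2 = v, t2 = t' & o2 = o])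
  (fun env es t vs t' o => forall vs2 t2 o2,
     evals p env es t vs2 t2 o2 -> [/\ vs2 = vs, t2 = t' & o2 = o])
  _ _ _ _ _ _ _ _ _ _ env e t v t' o H) => {env e t v t' o H}.
- by move=> env i t v2 t2 o2 K; inversion K.
- by move=> env t v2 t2 o2 K; inversion K.
- move=> env e1 e2 t v1 t1 o1 v2 t2 o2 _ IH1 _ IH2 w u q K; inversion K; subst.
  have [? ? ?] := IH1 _ _ _ ltac:(eassumption); subst.
  by have [-> -> ->] := IH2 _ _ _ ltac:(eassumption).
- move=> env e e1 e2 t t0 o0 v1 t1 o1 _ IH0 _ IH1 w u q K; inversion K; subst;
    have [? ? ?] := IH0 _ _ _ ltac:(eassumption); subst=> //.
  by have [-> -> ->] := IH1 _ _ _ ltac:(eassumption).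
- move=> env e e1 e2 t x y t0 o0 v2 t2 o2 _ IH0 _ IH2 w u q K; inversion K; subst;
    have [E ? ?] := IH0 _ _ _ ltac:(eassumption); subst=> //.
  case: E => ? ?; subst.
  by have [-> -> ->] := IH2 _ _ _ ltac:(eassumption).
- move=> env e1 e2 t v1 t1 o1 v2 t2 o2 _ IH1 _ IH2 w u q K; inversion K; subst.
  have [? ? ?] := IH1 _ _ _ ltac:(eassumption); subst.
  by have [-> -> ->] := IH2 _ _ _ ltac:(eassumption).
- move=> env f es t vs t1 o1 v t2 o2 _ IH1 _ IH2 w u q K; inversion K; subst.
  have [? ? ?] := IH1 _ _ _ ltac:(eassumption); subst.
  by have [-> -> ->] := IH2 _ _ _ ltac:(eassumption).
- move=> env e t v t1 o _ IH w u q K; inversion K; subst.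
  by have [-> -> ->] := IH _ _ _ ltac:(eassumption).
- by move=> env t w u q K; inversion K.
- move=> env e es t v t1 o1 vs t2 o2 _ IH1 _ IH2 w u q K; inversion K; subst.
  have [? ? ?] := IH1 _ _ _ ltac:(eassumption); subst.
  by have [-> -> ->] := IH2 _ _ _ ltac:(eassumption).
Qed.

(* Function 0 is the main function; it is started at time 0 on [args], and
   [runs p args o t] says that it halts at time t with output o. *)
Definition runs (p : program) (args : seq tree) (o : seq (nat * tree))
    (t : nat) : Prop :=
  exists v : tree, eval p args (nth ENil p 0) 0 v t o.

Definition output_by (B : nat) (o : seq (nat * tree)) : seq (nat * tree) :=
  [seq w <- o | w.1 <= B].

Definition enc_bool (x : bool) : tree := if x then Cons Nil Nil else Nil.

Fixpoint enc_nat (m : nat) : tree :=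
  if m is m'.+1 then Cons Nil (enc_nat m') else Nil.

Definition enc_seq (s : seq tree) : tree := foldr Cons Nil s.

(* Sign and unary magnitude.  Unary notation gives the algorithm no extra time,
   since the time bound is polynomial in the size of the graph alone. *)
Definition enc_int (k : int) : tree :=
  match k with
  | Posz m => Cons (enc_bool false) (enc_nat m)
  | Negz m => Cons (enc_bool true) (enc_nat m)
  end.

Definition enc_set n (S : {set 'I_n}) : tree :=
  enc_seq [seq enc_bool (i \in S) | i <- enum 'I_n].

Definition enc_graph n (G : sgraph 'I_n) : tree :=
  enc_seq [seq enc_seq [seq enc_bool (adj G i j) | j <- enum 'I_n]
          | i <- enum 'I_n].

Definition enc_input n (G : sgraph 'I_n) (a b : 'I_n) (k : int) : seq tree :=
  [:: enc_graph G; enc_nat a; enc_nat b; enc_int k].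

(* 4^k, read as 1 when k < 0 (there is then nothing to enumerate, but halting
   still takes time). *)
Definition four_pow (k : int) : nat := if k is Posz m then 4 ^ m else 1.

(* Main.v *)
(* Minimal a,b-separators S are handled through their a-side, the component C_a(S) of a in
   G \ S, so that S = N(C_a(S)).  A task is a connected set X containing a; it asks for the
   separators S of size at most k whose a-side is inclusion-minimal among those containing X.
   The first task is {a}, and each separator S found creates the tasks C_a(S) + x for x in S:
   if T is a separator of size at most k, then a task X inside C_a(T) that is as large as
   possible has T among its answers, since a smaller answer S would give a larger task.

   A task X is solved by a search over connected sets Y containing b.  The vertex cut between
   X and Y of minimum size that is closest to X has an a-side A, and by submodularity every
   answer T with Y in C_b(T) satisfies C_a(T) <= A.  Hence either T = N(A) or some v in N(A)
   lies in C_b(T), and the search goes on with C_b(N(A)) + v.  Each N(A) that is met is a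
   minimal a,b-separator, so a task meets at most as many cuts as there are separators in
   the output; moreover these are important separators, so there are at most 4^k of them.

   Closest minimum cuts are computed by reversing augmenting paths in the digraph where each
   vertex is split into an arc: reversing a path from s to t lowers by one the number of arcs
   that leave U, for every U containing s but not t. *)
From mathcomp Require Import all_boot all_order all_algebra zify.
(* Imported last, as seq also defines Nil and Cons. *)
Require Import Defs.
Set Implicit Arguments.
Unset Strict Implicit.
Unset Printing Implicit Defensive.

(** * Separators and closest minimum cuts *)

(** Time is charged as follows. Apart from {a}, every task comes from an output separator and one of
    its at most n vertices, so r outputs create at most n * r further tasks; a task visits at most
    min(4^k, r) distinct cuts, and a visit queues at most n sets Y. This bounds the number of steps
    performed while only r separators are known, hence the wait for the next output or for halting.
    A step must take time polynomial in n although the stored data grow with the output. So the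
    queues are stacks, touched only at the front, and membership among known cuts is tested in
    binary tries of depth n keyed by characteristic vectors. The program is a concrete term of the
    first-order language. To avoid counting evaluation steps for each function, the step is written
    in an auxiliary language whose only loop is a fold over a list cut off at the length N of a
    counter. Every term of it compiles to code with running time polynomial in N, whatever its data,
    so only its value remains to be computed. The unbounded outer loop, which produces the output,
    is written directly in the target language. *)

Lemma connect_ind (T : finType) (e : rel T) (P : pred T) (x y : T) :
  (forall u v, P u -> e u v -> P v) -> P x -> connect e x y -> P y.
Proof.
move=> He Px /connectP[p]; elim: p x Px => [|z p IH] x Px /=; first by move=> _ ->.
by case/andP=> exz; apply: IH; apply: He exz.
Qed.

Lemma disjointsU (T : finType) (A B C : {set T}) :
  [disjoint A & C] -> [disjoint B & C] -> [disjoint A :|: B & C].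
Proof. by rewrite !disjoints_subset subUset => -> ->. Qed.

Section Graph.
Variables (T : finType) (G : sgraph T).
Implicit Types (A B C D I S X Y U : {set T}) (a b u v x y : T).

Definition nbr A : {set T} := [set v | (v \notin A) && [exists u in A, adj G u v]].
(** No arc of [adj_del] touches S, so for x in S this is just {x}; hence the hypotheses x \notin S
    further on. *)
Definition cmp S x : {set T} := [set y | connect (adj_del G S) x y].

Lemma nbrP A v : reflect (v \notin A /\ exists2 u, u \in A & adj G u v) (v \in nbr A).
Proof.
rewrite inE; apply: (iffP andP) => [[vA /exists_inP[u]]|[vA [u uA uv]]]; split=> //.
  by exists u.
by apply/exists_inP; exists u.
Qed.

Lemma nbr_disjoint A : [disjoint A & nbr A].
Proof. by apply/pred0P=> v /=; rewrite inE; case: (v \in A). Qed.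

Lemma adj_nbr A u v : u \in A -> adj G u v -> v \notin A -> v \in nbr A.
Proof. by move=> uA uv vA; apply/nbrP; split=> //; exists u. Qed.

Lemma nbrS A B v : A \subset B -> v \in nbr A -> v \notin B -> v \in nbr B.
Proof.
by move=> sAB /nbrP[_ [u uA uv]] vB; apply: adj_nbr uv vB; apply: (subsetP sAB).
Qed.

Lemma nbrU A B : nbr (A :|: B) \subset nbr A :|: nbr B.
Proof.
apply/subsetP=> v /nbrP[]; rewrite in_setU negb_or => /andP[vA vB] [u].
by rewrite !in_setU => /orP[] u_ uv; rewrite (adj_nbr u_ uv) ?orbT.
Qed.

Lemma nbrI A B : nbr (A :&: B) \subset nbr A :|: nbr B.
Proof.
apply/subsetP=> v /nbrP[]; rewrite in_setI negb_and => vAB [u].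
rewrite in_setI in_setU => /andP[uA uB] uv.
by case/orP: vAB => v_; rewrite (adj_nbr _ uv v_) ?orbT.
Qed.

(** The two boundaries on the left have their union inside the union of those on the right, and
    their intersection inside the intersection: a vertex on both is outside A and B and adjacent to
    a vertex of A :&: B. The set I of ignored vertices serves the count of important separators. *)
Lemma nbr_submod I A B :
  #|nbr (A :&: B) :\: I| + #|nbr (A :|: B) :\: I| <= #|nbr A :\: I| + #|nbr B :\: I|.
Proof.
rewrite -cardsUI -[leqRHS]cardsUI; apply: leq_add; apply: subset_leq_card.
  rewrite -!setDUl setSD // subUset nbrI; exact: nbrU.
apply/subsetP=> v; rewrite !inE.
case: (v \in I) => //=; rewrite negb_and negb_or /= => /andP[/andP[_ /existsP[u]]].
rewrite inE => /andP[/andP[uA uB] uv] /andP[/andP[vA vB] _]; rewrite vA vB /=.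
by apply/andP; split; apply/existsP; exists u; rewrite ?uA ?uB.
Qed.

(** A vertex of B has no neighbour outside B and N(B). Taking the complement of the closed
    neighbourhood thus passes to the other side of a cut without enlarging its boundary. *)
Lemma nbr_coclosure B : nbr (~: (B :|: nbr B)) \subset nbr B.
Proof.
apply/subsetP=> v /nbrP[]; rewrite !inE negbK => /orP[vB [u]|//].
rewrite !inE negb_or negb_and negbK => /andP[uB /orP[uB'|]]; first by rewrite uB' in uB.
move=> /existsPn/(_ v); rewrite vB /= => nvu uv.
by rewrite adj_sym uv in nvu.
Qed.

(** * Components after deletion of a vertex set, and connected sets *)

Lemma adj_delE S x y : adj_del G S x y = [&& x \notin S, y \notin S & adj G x y].
Proof. by []. Qed.

Lemma adj_del_sym S : symmetric (adj_del G S).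
Proof. by move=> x y; rewrite !adj_delE adj_sym andbCA. Qed.

Lemma connect_del_sym S : connect_sym (adj_del G S).
Proof. exact: sym_connect_sym (@adj_del_sym S). Qed.

Lemma mem_cmp S x : x \in cmp S x.
Proof. by rewrite inE connect0. Qed.

Lemma cmp_disjoint S x : x \notin S -> [disjoint cmp S x & S].
Proof.
move=> xS; apply/pred0P=> y /=; apply/negbTE/negP=> /andP[].
rewrite inE => cxy; apply/negP.
by apply: (connect_ind (P := [pred z | z \notin S]) _ xS cxy) => u v _ /and3P[].
Qed.

Lemma nbr_cmp S x : x \notin S -> nbr (cmp S x) \subset S.
Proof.
move=> xS; apply/subsetP=> v /nbrP[vC [u uC uv]]; apply: contraNT vC => vS.
have uS: u \notin S by rewrite (disjointFr (cmp_disjoint xS)).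
move: uC; rewrite !inE => uC; apply: connect_trans uC _; apply: connect1.
by rewrite adj_delE uS vS.
Qed.

Lemma cmp_min S A x : x \in A -> nbr A \subset S -> cmp S x \subset A.
Proof.
move=> xA sAS; apply/subsetP=> y; rewrite inE => xy.
apply: (connect_ind (P := mem A) _ xA xy) => u v /= uA; rewrite adj_delE.
case/and3P=> _ vS uv; apply: contraNT vS => vA.
by apply: (subsetP sAS); apply: adj_nbr uv vA.
Qed.

Lemma cmp_co S A x : x \notin A -> x \notin nbr A -> nbr A \subset S -> [disjoint A & cmp S x].
Proof.
move=> xA xN sAS; rewrite disjoint_sym disjoints_subset.
have /subset_trans: cmp S x \subset ~: (A :|: nbr A); last apply.
  apply: cmp_min; first by rewrite in_setC in_setU negb_or xA.
  exact: subset_trans (nbr_coclosure A) sAS.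
by rewrite setCS subsetUl.
Qed.

(** Connectedness of B with base point x: everything outside B is deleted and all of B is still
    reached from x. *)
Definition conn x B := (x \in B) && (B \subset cmp (~: B) x).

Lemma conn_sub_cmp S B x : conn x B -> [disjoint B & S] -> B \subset cmp S x.
Proof.
case/andP=> xB sB dBS; apply: subset_trans sB _; apply/subsetP=> y; rewrite !inE.
apply: connect_sub => u v /and3P[]; rewrite !inE !negbK => uB vB uv; apply: connect1.
by rewrite adj_delE uv (disjointFr dBS uB) (disjointFr dBS vB).
Qed.

Lemma conn_cmp S x : conn x (cmp S x).
Proof.
rewrite /conn mem_cmp; apply/subsetP=> y.
rewrite inE => xy; rewrite inE.
suff /andP[] : (y \in cmp S x) && connect (adj_del G (~: cmp S x)) x y by [].
move: xy; apply: (connect_ind (P := fun y => (y \in cmp S x) &&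
  connect (adj_del G (~: cmp S x)) x y)); last by rewrite mem_cmp connect0.
move=> u v /andP[uC xu] uv.
have vC: v \in cmp S x.
  by move: uC; rewrite !inE => /connect_trans; apply; apply: connect1.
rewrite vC; apply: connect_trans xu _; apply: connect1.
by case/and3P: uv => _ _ uv; rewrite adj_delE in_setC in_setC !negbK uC vC.
Qed.

Lemma conn1 x : conn x [set x].
Proof. by rewrite /conn set11 sub1set mem_cmp. Qed.

Lemma conn_add B x v : conn x B -> v \in nbr B -> conn x (v |: B).
Proof.
case/andP=> xB sB /nbrP[vB [u uB uv]].
have sB' : B \subset cmp (~: (v |: B)) x.
  by apply: conn_sub_cmp; rewrite ?/conn ?xB // disjoints_subset setCK subsetUr.
rewrite /conn in_setU xB orbT subUset sB' andbT sub1set.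
move: (subsetP sB' _ uB); rewrite !inE => /connect_trans; apply; apply: connect1.
by rewrite adj_delE !inE uB eqxx uv orbT.
Qed.

(** * Minimal separators as boundaries of two components *)

Lemma separatesE a b S :
  separates G a b S = [&& a \notin S, b \notin S & b \notin cmp S a].
Proof.
rewrite /separates /components_del /equivalence_partition; apply/exists_inP/and3P.
  case=> A /imsetP[x xS ->] /exists_inP[B /imsetP[y yS ->]] /and3P[neq].
  rewrite !inE in xS yS *; case/andP=> aS xa; case/andP=> bS yb; split=> //.
  apply: contra neq => ab; apply/eqP/setP=> z; rewrite !inE.
  case: (z \in S) => //=.
  have xy : connect (adj_del G S) x y.
    by apply: connect_trans xa (connect_trans ab _); rewrite connect_del_sym.
  apply/idP/idP; apply: connect_trans => //; by rewrite connect_del_sym.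
case=> aS bS; rewrite inE => ab.
exists [set y in ~: S | connect (adj_del G S) a y]; first by apply/imsetP; exists a; rewrite ?inE.
apply/exists_inP; exists [set y in ~: S | connect (adj_del G S) b y].
  by apply/imsetP; exists b; rewrite ?inE.
apply/and3P; split; rewrite ?inE ?aS ?bS ?connect0 //.
apply: contra ab => /eqP/setP/(_ b); by rewrite !inE bS connect0.
Qed.

Lemma separates_sym a b S : separates G a b S = separates G b a S.
Proof. by rewrite !separatesE !inE connect_del_sym andbCA. Qed.

Lemma separatesP a b S : reflect
  (exists A, [/\ a \in A, b \notin A, a \notin S, b \notin S & nbr A \subset S])
  (separates G a b S).
Proof.
rewrite separatesE; apply: (iffP and3P) => [[aS bS ab]|[A [aA bA aS bS sA]]].
  by exists (cmp S a); split; rewrite ?mem_cmp ?nbr_cmp.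
by split=> //; apply: contra bA; apply: subsetP; apply: cmp_min.
Qed.

(** If S is minimal, the boundary of the component of a already separates, so it is all of S, and
    likewise for b. Conversely, a vertex of S missed by a smaller separator S' is adjacent to both
    components, which stay connected outside S', so it joins a to b. *)
Lemma min_sepP a b S : reflect
  [/\ separates G a b S, S \subset nbr (cmp S a) & S \subset nbr (cmp S b)]
  (min_separator G a b S).
Proof.
have half x y : minset (separates G x y) S -> S \subset nbr (cmp S x).
  case/minsetP => sepS minS; move: (sepS); rewrite separatesE => /and3P[xS yS xy].
  rewrite -{1}(minS (nbr (cmp S x))) ?nbr_cmp //.
  apply/separatesP; exists (cmp S x); split; rewrite ?mem_cmp //.
    by rewrite inE mem_cmp.
  by apply: contra yS; apply/subsetP/nbr_cmp.
apply: (iffP idP) => [minS|[sepS sa sb]].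
  split; [by case/minsetP: minS|exact: half minS|].
  apply: (half b a); apply/minsetP; case/minsetP: minS => sS mS.
  by rewrite separates_sym; split=> // B; rewrite separates_sym; apply: mS.
apply/minsetP; split=> // S' sepS' sS'S; apply/eqP; rewrite eqEsubset sS'S /=.
move: (sepS) (sepS'); rewrite !separatesE => /and3P[aS bS ab] /and3P[aS' bS' ab'].
have disj z : z \notin S -> z \notin S' -> cmp S z \subset cmp S' z.
  move=> zS zS'; apply: conn_sub_cmp (conn_cmp _ _) _.
  by apply: disjointWr (cmp_disjoint zS).
apply/subsetP=> s sS; apply: contraNT ab' => sS'.
have /nbrP[_ [u ua us]] := subsetP sa _ sS.
have /nbrP[_ [w wb ws]] := subsetP sb _ sS.
have {}ua := subsetP (disj a aS aS') _ ua; have {}wb := subsetP (disj b bS bS') _ wb.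
have uS' : u \notin S' by rewrite (disjointFr (cmp_disjoint aS')).
have wS' : w \notin S' by rewrite (disjointFr (cmp_disjoint bS')).
move: ua wb; rewrite !inE => ua wb.
apply: connect_trans ua _; rewrite connect_del_sym; apply: connect_trans wb _.
apply: (connect_trans (y := s)); apply: connect1; first by rewrite adj_delE wS' sS'.
by rewrite adj_delE sS' uS' adj_sym.
Qed.

Lemma min_sep_nbr a b S : min_separator G a b S ->
  [/\ a \notin S, b \notin S, b \notin cmp S a, nbr (cmp S a) = S & nbr (cmp S b) = S].
Proof.
case/min_sepP; rewrite separatesE => /and3P[aS bS ab] sa sb; split=> //.
  by apply/eqP; rewrite eqEsubset sa nbr_cmp.
by apply/eqP; rewrite eqEsubset sb nbr_cmp.
Qed.

(** A is the side of X in a vertex cut N(A) that may use vertices of neither X nor Y. *)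
Definition feasible X Y A := [&& X \subset A, [disjoint A & Y] & [disjoint nbr A & Y]].

Lemma feasibleU X Y A B : feasible X Y A -> feasible X Y B -> feasible X Y (A :|: B).
Proof.
case/and3P=> XA AY NAY /and3P[XB BY NBY]; apply/and3P; split.
- by apply: subset_trans XA (subsetUl _ _).
- exact: disjointsU.
- by apply: disjointWl (nbrU A B) _; apply: disjointsU.
Qed.

Lemma feasibleI X Y A B : feasible X Y A -> feasible X Y B -> feasible X Y (A :&: B).
Proof.
case/and3P=> XA AY NAY /and3P[XB BY NBY]; apply/and3P; split.
- by rewrite subsetI XA.
- by apply: disjointWl AY; apply: subsetIl.
- by apply: disjointWl (nbrI A B) _; apply: disjointsU.
Qed.

Lemma feasibleSr X Y Y' A : Y' \subset Y -> feasible X Y A -> feasible X Y' A.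
Proof.
by move=> s /and3P[XA AY NAY]; apply/and3P; split=> //; apply: disjointWr s _.
Qed.

Lemma feasibleSl X Y A A' : X \subset A' -> A' \subset A -> feasible X Y A -> feasible X Y A'.
Proof.
move=> XA' s /and3P[XA AY NAY]; apply/and3P; split=> //.
  by apply: disjointWl s _.
apply/pred0P=> v /=; apply/negbTE/negP=> /andP[vN vY].
case vA: (v \in A); first by rewrite (disjointFr AY) in vY.
by rewrite (disjointFr NAY (nbrS s vN (negbT vA))) in vY.
Qed.

(** The last clause makes A the least side of minimum boundary, not just a minimal one, so X and Y
    determine A. *)
Definition is_cut X Y A := feasible X Y A /\
  forall A', feasible X Y A' ->
    #|nbr A| <= #|nbr A'| /\ (#|nbr A'| = #|nbr A| -> A \subset A').

Lemma min_sep_sides a b S : min_separator G a b S -> [disjoint cmp S a & cmp S b].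
Proof.
move=> minS; have [aS bS ab NA NB] := min_sep_nbr minS.
by apply: cmp_co; rewrite ?NA.
Qed.

Section Cut.
Variables (a b : T) (X Y A : {set T}).
Hypotheses (conX : conn a X) (conY : conn b Y) (cutA : is_cut X Y A).
Let S := nbr A.

Lemma cut_a_in : a \in A.
Proof. by case: cutA => /and3P[/subsetP XA _ _] _; case/andP: conX => /XA. Qed.

Lemma cut_aS : a \notin S.
Proof. by rewrite inE cut_a_in. Qed.

Lemma cut_bS : b \notin S.
Proof.
by case: cutA => /and3P[_ _ NAY] _; case/andP: conY => bY _; rewrite (disjointFl NAY).
Qed.

Lemma cut_b_notin : b \notin A.
Proof.
by case: cutA => /and3P[_ NAY _] _; case/andP: conY => bY _; rewrite (disjointFl NAY).
Qed.

(** The component of a inside A still contains the connected set X, and its boundary lies in S; it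
    is feasible, so leastness of A makes it all of A. *)
Lemma cut_cmp : cmp S a = A.
Proof.
case: cutA => fA minA; have [XA AY NAY] := and3P fA.
have sub: cmp S a \subset A by apply: cmp_min cut_a_in _.
apply/eqP; rewrite eqEsubset sub.
have XS: [disjoint X & S] by apply: disjointWl XA (nbr_disjoint A).
have f: feasible X Y (cmp S a) by apply: feasibleSl (conn_sub_cmp conX XS) sub fA.
have [le eq] := minA _ f; apply: eq; apply/eqP.
by rewrite eqn_leq le andbT subset_leq_card // nbr_cmp // cut_aS.
Qed.

Lemma cut_sub_b : Y \subset cmp S b.
Proof. by case: cutA => /and3P[_ _ NAY] _; apply: conn_sub_cmp; rewrite // disjoint_sym. Qed.

Lemma cut_co_disjoint : [disjoint A & cmp S b :|: nbr (cmp S b)].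
Proof.
have AS := nbr_disjoint A.
rewrite disjoint_sym; apply: disjointsU; last first.
  by apply: disjointWl (nbr_cmp cut_bS) _; rewrite disjoint_sym.
by rewrite disjoint_sym; apply: cmp_co => //; [exact: cut_b_notin | exact: cut_bS].
Qed.

(** The complement of the closed neighbourhood of the component of b is feasible, and its boundary
    lies in N(C_b(S)), a subset of S. Since S has minimum size, the inclusion is an equality. *)
Lemma cut_nbr_b : nbr (cmp S b) = S.
Proof.
case: cutA => fA minA; have [XA AY NAY] := and3P fA.
apply/eqP; rewrite eqEcard nbr_cmp ?cut_bS //=.
pose A2 := ~: (cmp S b :|: nbr (cmp S b)).
have AA2 : A \subset A2 by rewrite -disjoints_subset cut_co_disjoint.
suff /minA[le _] : feasible X Y A2.
  by apply: leq_trans le _; apply: subset_leq_card; apply: nbr_coclosure.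
apply/and3P; split; first exact: subset_trans AA2.
  rewrite disjoints_subset setCS; apply: subset_trans (subsetUl _ _); exact: cut_sub_b.
apply: disjointWl (nbr_coclosure _) _; apply: disjointWr cut_sub_b _.
by rewrite disjoint_sym nbr_disjoint.
Qed.

Lemma cut_min_sep : min_separator G a b S.
Proof.
apply/min_sepP; rewrite cut_cmp cut_nbr_b; split=> //.
by rewrite separatesE cut_aS cut_bS cut_cmp cut_b_notin.
Qed.

End Cut.

(** With D the component of a off N(C) and B the component of b off N(D), the separator is N(B):
    each of its vertices touches both D and B. If C lies in the a-side of S', then the b-side of S'
    avoids N(D), so it lies in B, and this bounds the a-side of N(B) by that of S'. *)
Lemma refine_sep a b X C : conn a X -> feasible X [set b] C ->
  exists S, [/\ min_separator G a b S, S \subset nbr C, X \subset cmp S a &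
    forall S', min_separator G a b S' -> C \subset cmp S' a -> cmp S a \subset cmp S' a].
Proof.
move=> conX /and3P[XC Cb NCb].
have aX: a \in X by case/andP: conX.
have aC: a \in C by apply: subsetP aX.
have bC: b \notin C by rewrite (disjointFl Cb) ?set11.
have bN: b \notin nbr C by rewrite (disjointFl NCb) ?set11.
have aN: a \notin nbr C by rewrite inE aC.
pose D := cmp (nbr C) a.
have DC: D \subset C by apply: cmp_min.
have ND: nbr D \subset nbr C by apply: nbr_cmp.
have bD: b \notin D by apply: contra bC; apply: subsetP.
have bND: b \notin nbr D by apply: contra bN; apply: subsetP.
pose B := cmp (nbr D) b; exists (nbr B).
have dDB: [disjoint D & B] by apply: cmp_co.
have sBD: nbr B \subset nbr D by apply: nbr_cmp.
have dDN: [disjoint D & nbr B] by apply: disjointWr sBD (nbr_disjoint _).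
have bNB: b \notin nbr B by rewrite inE mem_cmp.
have aD: a \in D by apply: mem_cmp.
have aNB: a \notin nbr B by rewrite (disjointFr dDN).
have cB: cmp (nbr B) b = B.
  apply/eqP; rewrite eqEsubset cmp_min ?mem_cmp //=; apply: conn_sub_cmp (conn_cmp _ _) _.
  exact: nbr_disjoint.
have sep: separates G a b (nbr B).
  rewrite separatesE aNB bNB inE connect_del_sym.
  by move: cB => /setP/(_ a); rewrite inE (disjointFr dDB aD) => ->.
have DA: D \subset cmp (nbr B) a by apply: conn_sub_cmp (conn_cmp _ _) dDN.
have XA: X \subset cmp (nbr B) a.
  apply: subset_trans DA; apply: conn_sub_cmp conX _.
  by apply: disjointWl XC (nbr_disjoint _).
have minS: min_separator G a b (nbr B).
  apply/min_sepP; rewrite cB; split=> //.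
  apply/subsetP=> v vN; have /nbrP[_ [u uD uv]] := subsetP sBD v vN.
  apply: adj_nbr uv _; first exact: (subsetP DA).
  by rewrite (disjointFl (cmp_disjoint aNB)).
split=> //; first exact: subset_trans ND.
move=> S' minS' CS'; have [aS' bS' ab' NA' NB'] := min_sep_nbr minS'.
have dAB' := min_sep_sides minS'.
have B'B: cmp S' b \subset B.
  apply: conn_sub_cmp (conn_cmp _ _) _; rewrite disjoint_sym.
  apply/pred0P=> v /=; apply/negbTE/negP=> /andP[vN vB].
  have vA' := disjointFl dAB' vB.
  have := disjointFr (cmp_disjoint bS') vB; rewrite -{1}NA'.
  by rewrite (nbrS (subset_trans DC CS') vN) // vA'.
apply: conn_sub_cmp (conn_cmp _ _) _; rewrite disjoint_sym -NB'.
apply/pred0P=> v /=; apply/negbTE/negP=> /andP[vN vA].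
have vNB := disjointFr (cmp_disjoint aNB) vA.
have vB : v \notin B by rewrite -cB (disjointFr (min_sep_sides minS)).
by rewrite (nbrS B'B vN vB) in vNB.
Qed.
End Graph.

(** * Important separators *)

Section Count.
Variables (T : finType) (G : sgraph T).
Implicit Types (A B C D I S X Y U : {set T}) (a b u v x y : T).
Local Notation nbr := (nbr G).
Local Notation cmp := (cmp G).
Local Notation conn := (conn G).
Local Notation feasible := (feasible G).
Local Notation is_cut := (is_cut G).

(* Important separators, pushed from Y towards X, in the graph with I deleted;
   such a separator is represented by the set B of vertices on the side of Y. *)
Definition important X I Y B :=
  [&& feasible Y X B, [disjoint I & B],
   [forall B' : {set T}, (B \proper B') && feasible Y X B' ==>
      (#|nbr B :\: I| < #|nbr B' :\: I|)] &
   [forall D : {set T}, [&& Y \subset D, D \subset B & [disjoint nbr D & B]] ==>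
      (nbr B \subset nbr D)]].

(** By submodularity, the union of two sets of minimum boundary again has minimum boundary, so a
    largest minimiser contains all others. *)
Lemma furthest_feasible X I Y B : feasible Y X B ->
  exists2 B0, feasible Y X B0 & forall B, feasible Y X B ->
    #|nbr B0 :\: I| <= #|nbr B :\: I| /\
    (#|nbr B :\: I| = #|nbr B0 :\: I| -> B \subset B0).
Proof.
move=> fB; pose w B := #|nbr B :\: I| * #|T|.+1 + #|~: B|.
case: (arg_minnP w fB) => B0 fB0 minB0; exists B0 => //.
have wle C : feasible Y X C -> #|nbr B0 :\: I| <= #|nbr C :\: I|.
  move/minB0; rewrite /w => le; have le' : #|~: C| <= #|T| := max_card _.
  rewrite leqNgt; apply/negP=> lt.
  have : #|nbr C :\: I|.+1 * #|T|.+1 <= #|nbr B0 :\: I| * #|T|.+1 by rewrite leq_mul2r lt orbT.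
  by rewrite mulSn; lia.
move=> C fC; split; first exact: wle.
move=> eq; have := nbr_submod G I C B0; have := wle _ (feasibleI fC fB0).
have := minB0 _ (feasibleU fC fB0); rewrite /w => le1 le2 le3.
have le4: #|nbr (C :|: B0) :\: I| <= #|nbr B0 :\: I| by lia.
have {le1}: #|~: B0| <= #|~: (C :|: B0)|.
  have := leq_mul le4 (leqnn #|T|.+1); lia.
move=> le; have /eqP/setC_inj/setUidPr // : ~: (C :|: B0) == ~: B0.
by rewrite eqEcard setCS subsetUr.
Qed.

(** The potential is 2m - l, where l bounds the minimum cut from below. Branching on a vertex v of
    the furthest minimum cut, either v joins the side of Y and the minimum cut grows, or v joins the
    ignored set I and m drops by one while the minimum cut drops by at most one. The potential falls
    in both branches. *)
Lemma card_important X I Y l m :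
  (forall B, feasible Y X B -> l <= #|nbr B :\: I|) ->
  #|[set B | important X I Y B & #|nbr B :\: I| <= m]| * 2 ^ l <= 4 ^ m.
Proof.
have [s] := ubnP (#|~: I| + #|~: Y|).
elim: s I Y l m => // s IH I Y l m ltm lmin.
set P := [set B | _ & _].
have [->|[B1]] := set_0Vmem P; first by rewrite cards0.
rewrite inE => /andP[/and4P[fB1 _ _ _] leB1].
have [B0 fB0 minB0] := furthest_feasible I fB1.
pose q := #|nbr B0 :\: I|.
have qm: q <= m by apply: leq_trans leB1; case: (minB0 _ fB1).
suff : #|P| * 2 ^ q <= 4 ^ m.
  by apply: leq_trans; rewrite leq_mul2l leq_exp2l // lmin ?orbT.
(* Otherwise uncrossing with B0 makes B :|: B0 a larger feasible set of no larger boundary, against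
   importance of B. *)
have sub B : B \in P -> B0 \subset B.
  rewrite inE => /andP[/and4P[fB _ /forall_inP impB _] _].
  have := nbr_submod G I B B0; have [le _] := minB0 _ (feasibleI fB fB0).
  move=> sm; have le2: #|nbr (B :|: B0) :\: I| <= #|nbr B :\: I| by lia.
  apply/negPn/negP=> nsub.
  suff : #|nbr B :\: I| < #|nbr (B :|: B0) :\: I| by rewrite ltnNge le2.
  apply: impB; rewrite feasibleU // andbT properE subsetUl /=.
  by apply: contra nsub; apply: subset_trans; apply: subsetUr.
(* When N(B0) lies in I, B0 is the only candidate: the last clause of [important] with D = B0 puts
   N(B) inside I, so B has minimum boundary too and is contained in B0. *)
have [q0|qpos] := posnP q.
  rewrite q0 muln1; apply: leq_trans (_ : 1 <= _); last by rewrite expn_gt0.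
  rewrite -(cards1 B0); apply: subset_leq_card; apply/subsetP=> B BP.
  have sB := sub _ BP; move: BP; rewrite !inE => /andP[/and4P[fB dIB _ /forall_inP adjB] _].
  rewrite eqEsubset sB andbT.
  have NI: nbr B0 \subset I by rewrite -setD_eq0 -cards_eq0 -/q q0.
  have NB: nbr B \subset nbr B0.
    apply: adjB; apply/and3P; split=> //; [by case/and3P: fB0 | exact: disjointWl NI dIB].
  have [_ ] := minB0 _ fB; rewrite -/q q0; apply; apply/eqP.
  by rewrite cards_eq0 setD_eq0; apply: subset_trans NB NI.
have [v] : exists v, v \in nbr B0 :\: I by apply/card_gt0P.
rewrite inE => /andP[vI vN]; have vB0: v \notin B0 by case/nbrP: vN.
have YB0: Y \subset B0 by case/and3P: fB0.
have vY: v \notin Y by apply: contra vB0; apply: subsetP.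
(* P1 collects the B that contain v, P2 those with v in N(B); no third case exists, as v is in N(B0)
   and B0 is contained in B. *)
pose P1 := [set B | important X I (v |: Y) B & #|nbr B :\: I| <= m].
pose P2 := [set B | important X (v |: I) Y B & #|nbr B :\: (v |: I)| <= m.-1].
have sP: P \subset P1 :|: P2.
  apply/subsetP=> B BP; have sB := sub _ BP.
  move: BP; rewrite !inE => /andP[/and4P[fB dIB /forall_inP impB /forall_inP adjB] leB].
  have [vB|vB] := boolP (v \in B); apply/orP; [left|right].
    rewrite leB andbT; apply/and4P; split=> //.
    - case/and3P: fB => YB BX NBX; apply/and3P; split=> //.
      by rewrite subUset sub1set vB.
    - apply/forall_inP=> B' /andP[prop fB']; apply: impB; rewrite prop /=.
      case/and3P: fB' => YB' B'X NB'X; apply/and3P; split=> //.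
      by apply: subset_trans YB'; apply: subsetUr.
    - apply/forall_inP=> D /and3P[YD DB ND]; apply: adjB; rewrite DB ND !andbT.
      by apply: subset_trans YD; apply: subsetUr.
  have vNB: v \in nbr B by apply: nbrS sB vN vB.
  have cB: #|nbr B :\: I| = #|nbr B :\: (v |: I)|.+1.
    rewrite (cardsD1 v) in_setD vI vNB add1n; congr _.+1.
    by rewrite setDDl setUC.
  apply/andP; split; last by move: leB; rewrite cB; case: (m).
  apply/and4P; split=> //.
  - by rewrite disjoint_sym disjoint_sym; apply: disjointsU; rewrite ?disjoints1.
  - apply/forall_inP=> B' /impB; rewrite cB.
    rewrite (cardsD1 v (nbr B' :\: I)) setDDl setUC.
    by case: (_ \in _) => //; rewrite add0n; apply: ltnW.
  - by apply/forall_inP.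
have card1: #|P1| * 2 ^ q.+1 <= 4 ^ m.
  apply: IH => [|B fB].
    have := cardsC Y; have := cardsC (v |: Y); rewrite cardsU1 vY; lia.
  have fB': feasible Y X B.
    case/and3P: fB => YB BX NBX; apply/and3P; split=> //.
    by apply: subset_trans YB; apply: subsetUr.
  have [le eq] := minB0 _ fB'; rewrite ltn_neqAle le andbT.
  apply: contra vB0 => /eqP/esym/eq; move/subsetP; apply.
  by case/and3P: fB => /subsetP YB _ _; rewrite YB // setU11.
have card2: #|P2| * 2 ^ q.-1 <= 4 ^ m.-1.
  apply: IH => [|B fB].
    have := cardsC I; have := cardsC (v |: I); rewrite cardsU1 vI; lia.
  have [le _] := minB0 _ fB; move: le; rewrite -/q.
  rewrite (cardsD1 v (nbr B :\: I)) setDDl setUC -subn1 leq_subLR.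
  by case: (_ \in _) => // /leq_trans; apply; apply: leqnSn.
have le := leq_trans (subset_leq_card sP) (leq_card_setU _ _).
(* Scaled by 2 ^ q.-1, the two branches contribute at most 4 ^ m / 4 and 4 ^ m.-1, together half of
   4 ^ m. *)
have := leq_mul le (leqnn (2 ^ q.-1)); rewrite mulnDl.
move: card1 card2; have -> : 4 ^ m = 4 * 4 ^ m.-1 by rewrite -expnS prednK //; lia.
rewrite -(prednK qpos) !expnS /=; lia.
Qed.

(** Each A may come from its own Y, but its far side f A is important for X and {b} alone: a rival
    B' containing f A contains Y, and the complement of its closed neighbourhood would be a cut at
    least as good as A and so contain A, which leaves no room for B' to exceed f A. The far side
    determines A because both have the same boundary. *)
Lemma card_cuts a b X k (As : {set {set T}}) : conn a X ->
  (forall A, A \in As -> #|nbr A| <= k /\ exists2 Y, conn b Y & is_cut X Y A) ->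
  #|As| <= 4 ^ k.
Proof.
move=> conX cuts; pose f A := ~: (A :|: nbr A).
have facts A : A \in As -> [/\ nbr (f A) \subset nbr A, nbr A \subset nbr (f A) &
    important X set0 [set b] (f A)].
  move=> /cuts[_ [Y conY cutA]].
  have NfA: nbr (f A) \subset nbr A by apply: nbr_coclosure.
  pose B := cmp (nbr A) b.
  have NB: nbr B = nbr A := cut_nbr_b conY cutA.
  have bS : b \notin nbr A := cut_bS conY cutA.
  have bA : b \notin A := cut_b_notin conY cutA.
  have BfA: B \subset f A.
    rewrite -disjoints_subset disjoint_sym; apply: disjointsU.
      by apply: cmp_co.
    by rewrite disjoint_sym; apply: cmp_disjoint.
  have YfA: Y \subset f A.
    case: cutA => /and3P[_ AY NAY] _.
    by rewrite -disjoints_subset disjoint_sym; apply: disjointsU.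
  have XA: X \subset A by case: cutA => /and3P[].
  split=> //.
    apply/subsetP=> v vA; have := vA; rewrite -{1}NB => vB; apply: nbrS BfA vB _.
    by rewrite in_setC negbK in_setU vA orbT.
  apply/and4P; split.
  - apply/and3P; split; first by rewrite sub1set (subsetP BfA) ?mem_cmp.
      by rewrite disjoints_subset setCS; apply: subset_trans XA (subsetUl _ _).
    apply: disjointWl NfA _; apply: disjointWr XA _.
    by rewrite disjoint_sym nbr_disjoint.
  - by rewrite disjoints_subset sub0set.
  - apply/forall_inP=> B' /andP[/properP[sfB [w wB' wf]] /and3P[_ B'X NB'X]].
    rewrite !setD0 ltnNge; apply/negP=> le.
    pose A' := ~: (B' :|: nbr B').
    have NA': nbr A' \subset nbr B' := nbr_coclosure G B'.
    have fA': feasible X Y A'.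
      apply/and3P; split.
      - by rewrite -disjoints_subset disjoint_sym; apply: disjointsU.
      - rewrite disjoints_subset setCS; apply: subset_trans YfA _.
        by apply: subset_trans sfB (subsetUl _ _).
      - apply: disjointWl NA' _; apply: disjointWr (subset_trans YfA sfB) _.
        by rewrite disjoint_sym nbr_disjoint.
    have [le1 eq] := cutA.2 _ fA'.
    have le2 := subset_leq_card NfA; have le3 := subset_leq_card NA'.
    have AA' : A \subset A'.
      by apply: eq; apply/eqP; rewrite eqn_leq le1 andbT (leq_trans le3 (leq_trans le le2)).
    case/negP: wf; rewrite in_setC in_setU; apply/norP; split.
      by apply/negP=> /(subsetP AA'); rewrite in_setC in_setU wB'.
    apply/negP=> /nbrP[_ [u /(subsetP AA')]].
    rewrite in_setC in_setU => /norP[uB' /negP uN] uw; apply: uN.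
    by apply: adj_nbr wB' _ uB'; rewrite adj_sym.
  - apply/forall_inP=> D /and3P[]; rewrite sub1set => bD DfA NDf.
    have disjND v : v \in nbr A -> v \notin f A by rewrite in_setC in_setU negbK orbC => ->.
    have BD: B \subset D.
      apply: cmp_min => //; apply/subsetP=> v vD; apply: (subsetP NfA).
      by apply: (nbrS DfA vD); rewrite (disjointFr NDf vD).
    apply: subset_trans NfA _; apply/subsetP=> v vA; have := vA; rewrite -{1}NB => vB.
    by apply: (nbrS BD vB); apply: contra (disjND v vA); apply: subsetP.
have injf : {in As &, injective f}.
  have K A : A \in As -> A = ~: (f A :|: nbr (f A)).
    move=> AAs; have [s1 s2 _] := facts _ AAs.
    have -> : nbr (f A) = nbr A by apply/eqP; rewrite eqEsubset s1.
    apply/setP=> v; rewrite !in_setC !in_setU in_setC in_setU.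
    have := disjointFr (nbr_disjoint G A) (x := v).
    by case: (v \in A) => [->|_] //=; case: (v \in nbr A).
  by move=> A1 A2 /K{2}-> /K{2}-> ->.
rewrite -(card_in_imset injf) -[leqLHS]muln1.
apply: leq_trans (card_important (X := X) (I := set0) (Y := [set b]) (l := 0) k _) => //.
rewrite leq_mul2r /=; apply: subset_leq_card; apply/subsetP=> _ /imsetP[A AAs ->].
have [s1 _ imp] := facts _ AAs; rewrite inE imp setD0 /=.
by apply: leq_trans (subset_leq_card s1) _; case: (cuts _ AAs).
Qed.
End Count.

(** * Completeness of the search *)

Section Complete.
Variables (T : finType) (G : sgraph T) (a b : T) (K : nat).
Implicit Types (A B C D I S X Y U : {set T}) (u v x y : T).
Local Notation nbr := (nbr G).
Local Notation cmp := (cmp G).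
Local Notation conn := (conn G).
Local Notation feasible := (feasible G).
Local Notation is_cut := (is_cut G).

Definition solution S := min_separator G a b S && (#|S| < K).

Definition closest X S := [/\ solution S, X \subset cmp S a &
  forall S', solution S' -> X \subset cmp S' a -> cmp S' a \subset cmp S a ->
    cmp S a \subset cmp S' a].

(** Uncrossing: the union of A with the a-side of S is feasible, so its boundary is at least that of
    A, and the intersection has a boundary no larger than S. Refining the intersection to a minimal
    separator and using that S is closest puts the a-side of S inside A. *)
Lemma closest_sub_cut X Y A S : conn a X -> conn b Y -> Y \subset cmp S b ->
  is_cut X Y A -> closest X S -> #|nbr A| < K /\ cmp S a \subset A.
Proof.
move=> conX conY YS cutA [/andP[minS leS] XS closeS].
have [aS bS ab NA NB] := min_sep_nbr minS.
have dAB := min_sep_sides minS.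
have fS : feasible X Y (cmp S a).
  apply/and3P; split=> //; first by apply: disjointWr YS dAB.
  by rewrite NA disjoint_sym; apply: disjointWl YS (cmp_disjoint G bS).
have [le1 _] := cutA.2 _ fS; rewrite NA in le1.
split; first exact: leq_ltn_trans leS.
have bY: [set b] \subset Y by rewrite sub1set; case/andP: conY.
have fI := feasibleI fS cutA.1; have [le2 _] := cutA.2 _ (feasibleU fS cutA.1).
have := nbr_submod G set0 (cmp S a) A; rewrite !setD0 NA => le3.
have leI : #|nbr (cmp S a :&: A)| < K.
  by apply: leq_ltn_trans leS; rewrite -(leq_add2r #|nbr A|); apply: leq_trans le3; rewrite leq_add2l.
have [S' [minS' S'I XS' refS']] := refine_sep conX (feasibleSr bY fI).
have solS': solution S' by rewrite /solution minS' (leq_ltn_trans (subset_leq_card S'I)).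
have sub : cmp S a \subset cmp S' a.
  by apply: closeS => //; apply: refS' => //; apply: subsetIl.
apply: subset_trans sub _; rewrite -(cut_cmp conX cutA); apply: refS'.
  exact: cut_min_sep conX conY cutA.
by rewrite (cut_cmp conX cutA) subsetIr.
Qed.

Variable cut : {set T} -> {set T} -> {set T}.
Hypothesis cutP : forall X Y A, feasible X Y A -> is_cut X Y (cut X Y).

(** The function [cut] returns a set even when no feasible one exists, so feasibility is tested on
    its result. *)
Definition cut_ok X Y := feasible X Y (cut X Y) && (#|nbr (cut X Y)| < K).

(** V is any family closed under the rules of the search, so the order of exploration is immaterial.
    Only the branches with Y inside the b-side of S are followed; Y grows strictly along them, since
    v is outside Y and Y lies in the component of b. *)
Lemma closest_visited X (V : pred {set T}) S : conn a X ->
  (forall Y, conn b Y -> cut_ok X Y ->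
     (Y = [set b] \/ exists A v, [/\ V A, v \in nbr A & Y = v |: cmp (nbr A) b]) ->
     V (cut X Y)) ->
  closest X S -> V (cmp S a).
Proof.
move=> conX closedV closeS; have [/andP[minS leS] XS _] := closeS.
have [aS bS ab NA NB] := min_sep_nbr minS.
have dAB := min_sep_sides minS.
have step Y : conn b Y -> Y \subset cmp S b ->
    [/\ cut_ok X Y, is_cut X Y (cut X Y) & cmp S a \subset cut X Y].
  move=> conY YS.
  have fS : feasible X Y (cmp S a).
    apply/and3P; split=> //; first by apply: disjointWr YS dAB.
    by rewrite NA disjoint_sym; apply: disjointWl YS (cmp_disjoint G bS).
  have [le sub] := closest_sub_cut conX conY YS (cutP fS) closeS.
  by split=> //; [apply/andP; split=> //; case: (cutP fS) | exact: cutP fS].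
suff main s Y : #|~: Y| < s -> conn b Y -> Y \subset cmp S b -> V (cut X Y) -> V (cmp S a).
  have sb: [set b] \subset cmp S b by rewrite sub1set mem_cmp.
  have [okb _ _] := step _ (conn1 G b) sb.
  apply: (main _ [set b] (ltnSn _) (conn1 G b) sb).
  by apply: closedV; [exact: conn1 | exact: okb | left].
elim: s Y => // s IH Y ltY conY YS VY.
have [okY cutY subY] := step _ conY YS.
set A0 := cut X Y in cutY subY okY VY.
have [NS|] := boolP (nbr A0 \subset S).
  have E : nbr A0 = S.
    case/minsetP: minS => _; apply=> //.
    by have /min_sepP[] := cut_min_sep conX conY cutY.
  by rewrite -E (cut_cmp conX cutY).
case/subsetPn=> v vN vS.
have cN := cut_nbr_b conY cutY.
have conY' : conn b (v |: cmp (nbr A0) b) by apply: conn_add (conn_cmp _ _ _) _; rewrite cN.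
have subB : cmp (nbr A0) b \subset cmp S b.
  apply: conn_sub_cmp (conn_cmp _ _ _) _; rewrite -{1}NA disjoint_sym.
  apply/pred0P=> w /=; apply/negbTE/negP=> /andP[wN wB].
  have := cmp_disjoint G (cut_bS conY cutY) => /disjointFr/(_ wB).
  rewrite (nbrS subY wN) //.
  have := min_sep_sides (cut_min_sep conX conY cutY).
  by rewrite (cut_cmp conX cutY) => /disjointFl/(_ wB)->.
have YS' : v |: cmp (nbr A0) b \subset cmp S b.
  rewrite subUset subB andbT sub1set; apply: contraNT vS => vB.
  by rewrite -NB; apply: nbrS subB _ vB; rewrite cN.
apply: (IH _ _ conY' YS').
  rewrite -ltnS; apply: leq_trans ltY; rewrite ltnS; apply: proper_card; rewrite properE !setCS.
  rewrite (subset_trans (cut_sub_b conY cutY)) ?subsetUr //=.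
  apply/subsetPn; exists v; first exact: setU11.
  apply: contraL vN => vY; case/and3P: cutY.1 => _ _ NY.
  by rewrite (disjointFl NY vY).
have [ok _ _] := step _ conY' YS'.
by apply: closedV => //; right; exists A0, v.
Qed.

(** Induction on the size of the a-side: a solution with a smaller a-side is already in O, so the
    tasks it creates count among the candidates X. *)
Lemma solutions_complete (O : pred {set T}) :
  (forall S, O S -> solution S) ->
  (forall S, closest [set a] S -> O S) ->
  (forall S S' x, O S -> x \in S -> closest (x |: cmp S a) S' -> O S') ->
  forall S, solution S -> O S.
Proof.
move=> solO O1 O2 S.
have [s] := ubnP #|cmp S a|; elim: s S => // s IH S ltS solS.
have [minS leS] := andP solS; have [aS bS ab NA NB] := min_sep_nbr minS.
pose cand X := (X == [set a]) ||
  [exists S', O S' && [exists x in S', X == x |: cmp S' a]].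
pose P X := cand X && (X \subset cmp S a).
have P1 : P [set a] by rewrite /P /cand eqxx sub1set mem_cmp.
have [X /andP[candX XS] maxX] := arg_maxnP (fun X : {set T} => #|X|) P1.
suff closeX : closest X S.
  case/orP: candX => [/eqP E|/existsP[S' /andP[OS' /exists_inP[x xS' /eqP E]]]].
    by apply: O1; rewrite -E.
  by apply: (O2 S' _ x); rewrite -?E.
split=> // S' solS' XS' sub; apply/negPn/negP=> nsub.
have prop : cmp S' a \proper cmp S a by rewrite properE sub.
have OS' : O S'.
  by apply: IH => //; rewrite -ltnS; apply: leq_trans ltS; rewrite ltnS; apply: proper_card.
have [minS' _] := andP solS'; have [aS' _ _ NA' _] := min_sep_nbr minS'.
(* If S' missed the a-side of S, that side would be connected off S' and hence contained in the
   a-side of S'. *)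
have [x xS' xS] : exists2 x, x \in S' & x \in cmp S a.
  apply/exists_inP; apply: contraR nsub; rewrite negb_exists_in => /forall_inP no.
  apply: conn_sub_cmp (conn_cmp _ _ _) _; rewrite disjoint_sym.
  by apply/pred0P=> w /=; apply/negbTE/negP=> /andP[/no/negbTE->].
have : P (x |: cmp S' a).
  apply/andP; split; last by rewrite subUset sub1set xS.
  by apply/orP; right; apply/existsP; exists S'; rewrite OS'; apply/exists_inP; exists x.
move/maxX; apply/negP; rewrite -ltnNge.
apply: leq_ltn_trans (subset_leq_card XS') _.
rewrite cardsU1; have := cmp_disjoint G aS'; rewrite disjoint_sym => /disjointFr->//.
Qed.

End Complete.

(** * Augmenting paths *)

Section Flow.
Variable M : finType.
Implicit Types (D : rel M) (e : M * M) (l : seq (M * M)) (P : M -> option (seq (M * M))).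
Implicit Types (X Z U K : {set M}) (i j u v w : M).

Definition reverse_arc D e : rel M := fun x y =>
  if (x == e.1) && (y == e.2) then false
  else if (x == e.2) && (y == e.1) then true else D x y.

Definition reverse_arcs D l := foldr (fun e D' => reverse_arc D' e) D l.

(* [P j] is a path to j, as a list of arcs with the last one first. *)
Definition search0 X : M -> option (seq (M * M)) := fun j => if j \in X then Some [::] else None.

Definition extend D P j := foldr (fun i acc =>
  if P i is Some l then if D i j then Some ((i, j) :: l) else acc else acc) None (enum M).

Definition search_step D P : M -> option (seq (M * M)) := fun j =>
  if P j is Some l then Some l else extend D P j.

Definition search D X := iter #|M| (search_step D) (search0 X).

Definition known P := [set j | P j].

Definition augment X Z D := foldr (fun z acc =>
  if z \in Z then if search D X z is Some l then reverse_arcs D l else acc else acc) D (enum M).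

Definition residual X Z N D := iter N (augment X Z) D.

Lemma extendP D P j :
  (exists i l, [/\ P i = Some l, D i j & extend D P j = Some ((i, j) :: l)]) \/
  (extend D P j = None /\ forall i, P i -> ~~ D i j).
Proof.
have : (exists i l, [/\ P i = Some l, D i j & extend D P j = Some ((i, j) :: l)]) \/
  (extend D P j = None /\ forall i, i \in enum M -> P i -> ~~ D i j).
  rewrite /extend; elim: (enum M) => [|i s IH] /=; first by right.
  case Pi: (P i) => [l|]; last first.
    case: IH => [?|[-> no]]; [by left | right; split=> // i'].
    by rewrite inE => /orP[/eqP->|/no//]; rewrite Pi.
  case Dij: (D i j); first by left; exists i, l.
  case: IH => [?|[-> no]]; [by left | right; split=> // i'].
  by rewrite inE => /orP[/eqP->|/no//]; rewrite Dij.
case=> [|[? no]]; [by left | right; split=> // i].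
by apply: no; rewrite mem_enum.
Qed.

Lemma search_step_known D P j :
  search_step D P j = (P j || [exists i, P i && D i j]) :> bool.
Proof.
rewrite /search_step; case Pj: (P j) => [l|] //=.
have [[i [l [Pi Dij ->]]]|[-> no]] := extendP D P j.
  by apply/esym/existsP; exists i; rewrite Pi.
by apply/esym/existsP=> -[i /andP[/no/negP]].
Qed.

Definition dclosed D K := forall i j, i \in K -> D i j -> j \in K.

(** Each round finds a new vertex unless the known set is already closed, so after #|M| rounds it is
    closed or contains every vertex. *)
Lemma search_closed D X : dclosed D (known (search D X)).
Proof.
rewrite /search.
have : dclosed D (known (iter #|M| (search_step D) (search0 X))) \/
    #|M| <= #|known (iter #|M| (search_step D) (search0 X))|.
  elim: #|M| => [|m IH]; first by right.
  set P := iter m _ _ in IH; rewrite iterS -/P.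
  have [cl|ncl] := boolP [forall i, forall j, (i \in known P) && D i j ==> (j \in known P)].
    have E : known (search_step D P) = known P.
      apply/setP=> j; rewrite !inE search_step_known.
      apply/orP/idP=> [[//|/existsP[i Pij]]|]; last by left.
      by move/forallP/(_ i)/forallP/(_ j): cl; rewrite !inE Pij.
    rewrite E; left=> i j iK Dij.
    by move/forallP/(_ i)/forallP/(_ j): cl; rewrite iK Dij.
  case: IH => [cl|le].
    case/negP: ncl; apply/forallP=> i; apply/forallP=> j; apply/implyP=> /andP[].
    exact: cl.
  right; apply: leq_ltn_trans le _; apply: proper_card; apply/properP; split.
    by apply/subsetP=> j; rewrite !inE search_step_known => ->.
  case/forallPn: ncl => i /forallPn[j]; rewrite negb_imply => /andP[/andP[iK Dij] jK].
  exists j => //; rewrite inE search_step_known; apply/orP; right.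
  by apply/existsP; exists i; rewrite inE in iK; rewrite iK.
case=> // full i j _ _.
suff -> : known (iter #|M| (search_step D) (search0 X)) = setT by rewrite inE.
by apply/eqP; rewrite eqEcard subsetT cardsT.
Qed.

Lemma search_source D X : X \subset known (search D X).
Proof.
apply/subsetP=> x xX; rewrite /search; elim: #|M| => [|m IH].
  by rewrite inE /= /search0 xX.
by move: IH; rewrite !inE iterS search_step_known => ->.
Qed.

Lemma search_min D X K : X \subset K -> dclosed D K -> known (search D X) \subset K.
Proof.
move=> XK clK; rewrite /search; elim: #|M| => [|m IH].
  by apply/subsetP=> x; rewrite inE /= /search0; case: ifP => // /(subsetP XK).
apply/subsetP=> j; rewrite inE iterS search_step_known => /orP[Pj|/existsP[i /andP[Pi Dij]]].
  by apply: (subsetP IH); rewrite inE.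
by apply: clK Dij; apply: (subsetP IH); rewrite inE.
Qed.

(** The final conditions make the path simple: its endpoint occurs on no earlier arc, so reversing
    the earlier arcs leaves the last one in place. *)
Fixpoint valid_path D X l j : bool := match l with
  | [::] => j \in X
  | (i, j') :: l' => [&& j' == j, D i j, valid_path D X l' i, i != j &
                      all (fun e => (e.1 != j) && (e.2 != j)) l']
  end.

Lemma search_valid D X j l : search D X j = Some l -> valid_path D X l j.
Proof.
(* The extra clause keeps all vertices of a path among the known ones, so a newly found j cannot lie
   on the path it extends. *)
suff : search D X j = Some l ->
  valid_path D X l j /\ all (fun e => search D X e.1 && search D X e.2) l by move=> H /H[].
rewrite /search; elim: #|M| j l => [|m IH] j l.
  by rewrite /= /search0; case: ifP => // jX [<-].
rewrite iterS; set P := iter m _ _ in IH *.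
have mono l' : all (fun e => P e.1 && P e.2) l' ->
    all (fun e => search_step D P e.1 && search_step D P e.2) l'.
  by apply: sub_all => e; rewrite !search_step_known => /andP[-> ->].
rewrite {1}/search_step; case Pj: (P j) => [l0|].
  by case=> <-; have [v al] := IH _ _ Pj; split; rewrite // mono.
have [[i [l0 [Pi Dij ->]]] [<-]|[-> //]] := extendP D P j.
have [v al] := IH _ _ Pi; split=> /=.
  rewrite eqxx Dij v /=; apply/andP; split.
    by apply/eqP=> E; rewrite E Pj in Pi.
  apply: sub_all al => e /andP[e1 e2].
  by apply/andP; split; apply/eqP=> E; rewrite E Pj in e1 e2.
rewrite !search_step_known Pi /= mono // andbT; apply/orP; right.
by apply/existsP; exists i; rewrite Pi.
Qed.

(** A relation carries no multiplicities: reversing an arc whose opposite is present would merge the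
    two and spoil the count of arcs. Reversals preserve this condition. *)
Definition asym D := forall x y, D x y -> D y x = false.

Definition outdeg D U := #|[set e : M * M | [&& e.1 \in U, e.2 \notin U & D e.1 e.2]]|.

Lemma asym_reverse D e : asym D -> asym (reverse_arc D e).
Proof.
move=> aD x y; rewrite /reverse_arc; case: ifP => // n1.
case: ifP => [/andP[/eqP-> /eqP->] _|n2 Dxy]; first by rewrite !eqxx.
case: ifP => // n3; case: ifP => [/andP[/eqP Ey /eqP Ex]|_]; last exact: aD.
by rewrite Ex Ey !eqxx in n1.
Qed.

Lemma outdeg_reverse D u w U : asym D -> D u w ->
  outdeg (reverse_arc D (u, w)) U + (u \in U) = outdeg D U + (w \in U).
Proof.
move=> aD Duw; have wu := aD _ _ Duw; rewrite /outdeg.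
set A := [set _ | _]; set B := [set _ | _].
have neq x y : x \in U -> y \in U = false -> (x == y) = false.
  by move=> xU yU; apply: contraFF yU => /eqP <-.
have neq' x y : x \in U = false -> y \in U -> (x == y) = false.
  by move=> xU yU; rewrite eq_sym neq.
case uU: (u \in U); case wU: (w \in U) => /=.
- congr (_ + 1); apply: eq_card => -[x y]; rewrite !inE /reverse_arc /=.
  case xU: (x \in U); case yU: (y \in U) => //=.
  by rewrite (neq' y u) // (neq' y w) // !andbF.
- rewrite (cardsD1 (u, w) B) inE /= uU wU Duw addn0 addnC; congr (_ + _).
  apply: eq_card => -[x y]; rewrite !inE /reverse_arc /= xpair_eqE.
  case xU: (x \in U); case yU: (y \in U) => //=; rewrite ?andbF //.
  by rewrite (neq' y u) // andbF; case: ifP.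
- rewrite (cardsD1 (w, u) A) inE /= uU wU /reverse_arc /= !eqxx addn0 addnC /=.
  rewrite (neq w u) //=; congr (_ + _).
  apply: eq_card => -[x y]; rewrite !inE /reverse_arc /= xpair_eqE.
  case xU: (x \in U); case yU: (y \in U) => //=; rewrite ?andbF //.
  rewrite (neq x u) //=; case: ifP => //= /andP[/eqP-> /eqP->]; by rewrite wu.
- congr (_ + _); apply: eq_card => -[x y]; rewrite !inE /reverse_arc /=.
  case xU: (x \in U); case yU: (y \in U) => //=.
  by rewrite (neq x u) // (neq x w).
Qed.

(** The changes of outdegree telescope along the path, which starts in X and thus in U. The last
    conclusion says that arcs at vertices off the path are untouched in both directions; it keeps
    the next arc available in the induction. *)
Lemma reverse_valid D X U l j : asym D -> valid_path D X l j -> X \subset U ->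
  [/\ asym (reverse_arcs D l), outdeg (reverse_arcs D l) U + 1 = outdeg D U + (j \in U) &
   forall x y, x != j -> all (fun e => (e.1 != x) && (e.2 != x)) l ->
     (reverse_arcs D l x y = D x y) * (reverse_arcs D l y x = D y x)].
Proof.
move=> aD + XU; elim: l j => [|[i j'] l IH] j /=.
  by move=> jX; split; rewrite // (subsetP XU _ jX).
case/and5P=> /eqP-> Dij vl neq fresh; have [aD' od unt] := IH _ vl.
have jni : j != i by rewrite eq_sym.
have D'ij : reverse_arcs D l i j by rewrite (unt j i).
split; first exact: asym_reverse.
  by have := outdeg_reverse U aD' D'ij; lia.
move=> x y xj /andP[/andP[/= ix jx] al]; have xi : x != i by rewrite eq_sym.
rewrite /reverse_arc /= (negbTE xj) (negbTE xi) !andbF /=.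
by rewrite !(unt x y).
Qed.

Lemma outdeg0_closed D U : outdeg D U = 0 -> dclosed D U.
Proof.
move=> /eqP; rewrite cards_eq0 => /eqP/setP od i j iU Dij; apply/negPn/negP=> jU.
by have := od (i, j); rewrite !inE /= iU jU Dij.
Qed.

(** Here q counts the successful augmentations; a round that finds no path leaves the digraph
    unchanged and certifies that no sink is reachable. *)
Lemma residual_outdeg X Z N D : asym D ->
  exists q, [/\ asym (residual X Z N D),
    forall U, X \subset U -> [disjoint U & Z] -> outdeg (residual X Z N D) U + q = outdeg D U &
    N <= q \/ [disjoint known (search (residual X Z N D) X) & Z]].
Proof.
move=> aD; elim: N => [|N [q [aN od H]]].
  by exists 0; split=> // [U _ _|]; [rewrite addn0 | left].
rewrite /residual iterS -/(residual X Z N D).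
set DN := residual X Z N D in aN od H *.
have : (augment X Z DN = DN /\ forall z, z \in enum M -> z \in Z -> search DN X z = None) \/
  exists z l, [/\ z \in Z, search DN X z = Some l & augment X Z DN = reverse_arcs DN l].
  rewrite /augment; elim: (enum M) => [|z s IH] /=; first by left.
  case zZ: (z \in Z); last first.
    case: IH => [[-> no]|?]; [left; split=> // z'|by right].
    by rewrite inE => /orP[/eqP->|/no//]; rewrite zZ.
  case sz: (search DN X z) => [l|]; first by right; exists z, l.
  case: IH => [[-> no]|?]; [left; split=> // z'|by right].
  by rewrite inE => /orP[/eqP->|/no//]; rewrite sz.
case=> [[-> no]|[z [l [zZ sz ->]]]].
  exists q; split=> //; right; apply/pred0P=> z /=; apply/negbTE/negP=> /andP[].
  by rewrite inE => kz zZ; rewrite no ?mem_enum in kz.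
have v := search_valid sz.
exists q.+1; split; first by case: (reverse_valid aN v (subsetT X)).
  move=> U XU UZ; have [_ + _] := reverse_valid aN v XU.
  by rewrite (disjointFl UZ zZ) -(od U XU UZ); lia.
case: H => [le|dis]; first by left.
by have := disjointFl dis zZ; rewrite inE sz.
Qed.

(** No residual arc leaves the reachable set R, so its original outdegree is exactly q, a lower
    bound for every U. When U attains q, no residual arc leaves U either, so U contains R. *)
Theorem min_cut X Z N D U1 : asym D ->
  X \subset U1 -> [disjoint U1 & Z] -> outdeg D U1 <= N ->
  let R := known (search (residual X Z N D) X) in
  [/\ X \subset R, [disjoint R & Z] & forall U, X \subset U -> [disjoint U & Z] ->
    outdeg D R <= outdeg D U /\ (outdeg D U = outdeg D R -> R \subset U)].
Proof.
move=> aD XU1 U1Z le1 R; have [q [aN od H]] := residual_outdeg X Z N aD.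
have XR: X \subset R by apply: search_source.
have min U : X \subset U -> outdeg (residual X Z N D) U = 0 -> R \subset U.
  by move=> XU od0; apply: search_min XU (outdeg0_closed od0).
have RZ: [disjoint R & Z].
  (* If all N rounds succeeded, they used up every arc leaving U1, so R is confined to U1. *)
  case: H => // le; apply: (disjointWl _ U1Z); apply: min => //.
  by have := od _ XU1 U1Z; lia.
have odR : outdeg (residual X Z N D) R = 0.
  apply/eqP; rewrite cards_eq0; apply/eqP/setP=> -[x y]; rewrite !inE /=.
  apply/negbTE/negP=> /and3P[xR yR Dxy]; case/negP: yR.
  have xR' : x \in R by rewrite inE.
  by have := search_closed xR' Dxy; rewrite inE.
have := od _ XR RZ; rewrite odR add0n => <-.
split=> // U XU UZ; have := od _ XU UZ; split; first by lia.
by move=> E; apply: min => //; lia.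
Qed.

End Flow.

(** * Vertex cuts from arc cuts *)

Section Split.
Variables (n : nat) (G : sgraph 'I_n).
Implicit Types (A X Y : {set 'I_n}) (u v : 'I_n) (U : {set 'I_(n + n)}).
Local Notation nbr := (nbr G).
Local Notation feasible := (feasible G).

(* Vertex v becomes the arc from [lshift n v] to [rshift n v]. *)
Definition split_graph : rel 'I_(n + n) := fun i j =>
  match split i, split j with
  | inl u, inr v => u == v
  | inr u, inl v => adj G u v
  | _, _ => false
  end.

Lemma splitl u : split (lshift n u) = inl u. Proof. exact: (unsplitK (inl u)). Qed.
Lemma splitr u : split (rshift n u) = inr u. Proof. exact: (unsplitK (inr u)). Qed.

Lemma split_lr u v : split_graph (lshift n u) (rshift n v) = (u == v).
Proof. by rewrite /split_graph splitl splitr. Qed.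
Lemma split_rl u v : split_graph (rshift n u) (lshift n v) = adj G u v.
Proof. by rewrite /split_graph splitl splitr. Qed.
Lemma split_ll u v : split_graph (lshift n u) (lshift n v) = false.
Proof. by rewrite /split_graph !splitl. Qed.
Lemma split_rr u v : split_graph (rshift n u) (rshift n v) = false.
Proof. by rewrite /split_graph !splitr. Qed.

Lemma split_asym : asym split_graph.
Proof.
move=> i j; case: (split_ordP i) => u ->; case: (split_ordP j) => v ->;
  rewrite ?split_ll ?split_rr ?split_lr ?split_rl //.
  by move/eqP->; rewrite adj_irrefl.
by move=> uv; apply/negbTE; apply: contraTneq uv => ->; rewrite adj_irrefl.
Qed.

Definition sources X : {set 'I_(n + n)} := [set i | if split i is inr v then v \in X else false].
Definition sinks Y : {set 'I_(n + n)} := [set i | if split i is inl v then v \in Y else false].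

Lemma sources_l X u : (lshift n u \in sources X) = false. Proof. by rewrite inE splitl. Qed.
Lemma sources_r X u : (rshift n u \in sources X) = (u \in X). Proof. by rewrite inE splitr. Qed.
Lemma sinks_l Y u : (lshift n u \in sinks Y) = (u \in Y). Proof. by rewrite inE splitl. Qed.
Lemma sinks_r Y u : (rshift n u \in sinks Y) = false. Proof. by rewrite inE splitr. Qed.

(** Cuts have at most n vertices, so n rounds of augmentation suffice. *)
Definition cut_residual X Y := residual (sources X) (sinks Y) n split_graph.

Definition cut X Y := [set v | rshift n v \in known (search (cut_residual X Y) (sources X))].

Definition lift A : {set 'I_(n + n)} :=
  [set i | match split i with inl v => v \in A :|: nbr A | inr v => v \in A end].

Lemma lift_l A v : (lshift n v \in lift A) = (v \in A :|: nbr A).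
Proof. by rewrite inE splitl. Qed.
Lemma lift_r A v : (rshift n v \in lift A) = (v \in A).
Proof. by rewrite inE splitr. Qed.

Lemma outdeg_lift A : outdeg split_graph (lift A) <= #|nbr A|.
Proof.
pose f v := (lshift n v, rshift n v).
rewrite /outdeg -(card_imset (f := f) (nbr A)); last first.
  by move=> u v E; apply: lshift_inj (congr1 fst E).
apply: subset_leq_card; apply/subsetP=> -[i j]; rewrite inE /= => /and3P[].
case: (split_ordP i) => u ->; case: (split_ordP j) => v ->;
  rewrite ?split_ll ?split_rr ?split_lr ?split_rl // ?lift_l ?lift_r.
  move=> /setUP[uA /negP no /eqP E|uN uA /eqP E]; first by rewrite -E in no.
  by rewrite -E; apply/imsetP; exists u.
rewrite in_setU => uA /norP[vA /negP no] uv; case: no; exact: adj_nbr uA uv vA.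
Qed.

(** Arcs coming from edges have capacity one, not infinity, so each v in the boundary is charged to
    an arc leaving U that ends at one of its copies: its own split arc, or an arc entering its first
    copy. *)
Lemma nbr_outdeg U : #|nbr [set v | rshift n v \in U]| <= outdeg split_graph U.
Proof.
pose vertex i := match @split n n i with inl v => v | inr v => v end.
set A := [set v | _]; rewrite /outdeg.
apply: leq_trans (leq_imset_card (fun e : 'I_(n + n) * 'I_(n + n) => vertex e.2) _).
apply: subset_leq_card; apply/subsetP=> v /nbrP[vA [u uA uv]].
rewrite inE in uA; rewrite inE in vA.
have [lv|lv] := boolP (lshift n v \in U); apply/imsetP.
  exists (lshift n v, rshift n v); last by rewrite /vertex splitr.
  by rewrite inE /= lv vA split_lr eqxx.
exists (rshift n u, lshift n v); last by rewrite /vertex splitl.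
by rewrite inE /= lv uA split_rl uv.
Qed.

Lemma cut_sub X Y : X \subset cut X Y.
Proof.
apply/subsetP=> v vX; rewrite inE; apply: (subsetP (search_source _ _)).
by rewrite inE splitr.
Qed.

(** Minimality and leastness transfer through [lift] and [nbr_outdeg]. With unit capacities the cut
    R might still pass through edges at Y, so feasibility of [cut X Y] needs an argument of its own,
    which uses that R is the least minimum cut. *)
Lemma cutP X Y A : feasible X Y A -> is_cut G X Y (cut X Y).
Proof.
move=> fA.
have lift_fam B : feasible X Y B -> sources X \subset lift B /\ [disjoint lift B & sinks Y].
  case/and3P=> XB BY NBY; split.
    apply/subsetP=> i; case: (split_ordP i) => v ->; rewrite !inE ?splitl ?splitr //.
    exact: subsetP.
  apply/pred0P=> i /=; apply/negbTE/negP=> /andP[iL]; rewrite inE.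
  case: (split_ordP i) iL => v ->; rewrite ?splitl ?splitr // lift_l in_setU => + vY.
  by rewrite (disjointFl BY vY) (disjointFl NBY vY).
have [XA AY] := lift_fam _ fA.
have le : outdeg split_graph (lift A) <= n.
  by apply: leq_trans (outdeg_lift A) _; rewrite -[leqRHS]card_ord max_card.
have [] := min_cut split_asym XA AY le; rewrite -/(cut_residual X Y).
set R := known _ => XR RY minR.
have cutE : cut X Y = [set v | rshift n v \in R] by [].
clearbody R.
have leR B : feasible X Y B -> #|nbr (cut X Y)| <= #|nbr B|.
  move=> fB; have [XB BY] := lift_fam _ fB; have [le1 _] := minR _ XB BY.
  rewrite cutE; apply: leq_trans (nbr_outdeg R) _; apply: leq_trans le1 _.
  exact: outdeg_lift.
(* The only arc into the second copy of v is its split arc. Under either alternative, removing this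
   copy from R does not raise the outdegree, against leastness of R. *)
have drop v : rshift n v \in R -> v \notin X ->
    (lshift n v \notin R \/ exists2 y, y \in Y & adj G v y) -> False.
  move=> vR vX H; pose R' := R :\ rshift n v.
  have XR' : sources X \subset R'.
    by rewrite subsetD1 XR inE splitr.
  have R'Y : [disjoint R' & sinks Y] by apply: disjointWl RY; apply: subD1set.
  have [le1 eq] := minR _ XR' R'Y.
  suff le2 : outdeg split_graph R' <= outdeg split_graph R.
    have /eq/subsetP/(_ _ vR) : outdeg split_graph R' = outdeg split_graph R.
      by apply/eqP; rewrite eqn_leq le1 le2.
    by rewrite !inE eqxx.
  rewrite /outdeg.
  have sub e : e.1 \in R' -> e.2 \notin R' -> split_graph e.1 e.2 ->
      (e.1 \in R) && (e.2 \notin R) || (e == (lshift n v, rshift n v)) && (lshift n v \in R).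
    case: e => i j /=; rewrite in_setD1 => /andP[inv iR]; rewrite iR /= in_setD1 negb_and negbK.
    case/orP=> [/eqP->|->//]; case: (split_ordP i) iR inv => u -> uR; rewrite ?split_rr // split_lr.
    by move=> _ /eqP E; rewrite E in uR *; rewrite uR eqxx orbT.
  case: H => [lv|[y yY vy]].
    apply: subset_leq_card; apply/subsetP=> e; rewrite !inE => /and3P[e1 e2 e3].
    have := sub e; rewrite !inE e1 e2 e3 (negbTE lv) andbF orbF => /(_ isT isT isT)/andP[-> ->].
    by [].
  have yR : lshift n y \notin R by rewrite (disjointFl RY) // inE splitl.
  (* The arc from v to y leaves R and disappears with v; it pays for the split arc of v, which may
     now leave. *)
  rewrite [leqRHS](cardsD1 (rshift n v, lshift n y)) [in leqRHS]inE /= vR yR split_rl vy.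
  rewrite add1n; set B := [set _ | _] :\ _.
  apply: leq_trans (_ : #|(lshift n v, rshift n v) |: B| <= _); last first.
    by rewrite cardsU1; case: (_ \notin _).
  apply: subset_leq_card; apply/subsetP=> e; rewrite inE => /and3P[e1 e2 e3].
  rewrite !inE; case/orP: (sub e e1 e2 e3) => [/andP[-> ->]|/andP[-> //]].
  rewrite e3 /= andbT; apply/orP; right; apply: contraTneq e1 => ->.
  by rewrite /= !inE eqxx.
have [XA0 AY0 NAY0] := and3P fA.
have cX : X \subset cut X Y := cut_sub X Y.
have lY y : y \in Y -> lshift n y \notin R.
  by move=> yY; rewrite (disjointFl RY) // inE splitl.
split; last first.
  move=> B fB; split; first exact: leR.
  move=> E; have [XB BY] := lift_fam _ fB; have [le1 eq] := minR _ XB BY.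
  have sR : R \subset lift B.
    apply: eq; apply/eqP; rewrite eqn_leq le1 andbT.
    by apply: leq_trans (outdeg_lift B) _; rewrite E cutE; apply: nbr_outdeg.
  by apply/subsetP=> v; rewrite cutE inE => /(subsetP sR); rewrite inE splitr.
apply/and3P; split=> //.
  apply/pred0P=> y /=; apply/negbTE/negP=> /andP[]; rewrite cutE inE => yR yY.
  apply: (drop y yR); last by left; apply: lY.
  by apply: contraL yY => /(subsetP XA0) yA; rewrite (disjointFr AY0 yA).
apply/pred0P=> y /=; apply/negbTE/negP=> /andP[/nbrP[_ [u]]]; rewrite cutE inE => uR uy yY.
apply: (drop u uR); last by right; exists y.
apply: contraL yY => /(subsetP XA0) uA.
have [yA|yA] := boolP (y \in A); first by rewrite (disjointFr AY0 yA).
by rewrite (disjointFr NAY0 (adj_nbr uA uy yA)).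
Qed.

End Split.

(** * Polynomial-time expressions and their compilation *)

(** Silent evaluation; the exact cost c' does not depend on the starting time, so costs can be
    added. *)
Definition pev p env e v c := exists2 c', c' <= c & forall t, eval p env e t v (t + c') [::].
Definition pevs p env es vs c := exists2 c', c' <= c & forall t, evals p env es t vs (t + c') [::].

Section PureRules.
Variable p : program.

Lemma pev_weak env e v c c' : c <= c' -> pev p env e v c -> pev p env e v c'.
Proof. by move=> le [q lq H]; exists q => //; apply: leq_trans le. Qed.

Lemma pev_var env i v : nth Nil env i = v -> pev p env (EVar i) v 1.
Proof. by move=> <-; exists 1 => // t; rewrite addn1; apply: eval_var. Qed.

Lemma pev_nil env : pev p env ENil Nil 1.
Proof. by exists 1 => // t; rewrite addn1; apply: eval_nil. Qed.

Lemma pev_cons env e1 e2 v1 v2 c1 c2 :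
  pev p env e1 v1 c1 -> pev p env e2 v2 c2 -> pev p env (ECons e1 e2) (Cons v1 v2) (1 + c1 + c2).
Proof.
move=> [q1 l1 H1] [q2 l2 H2]; exists (1 + q1 + q2) => [|t]; first by lia.
have := eval_cons (H1 t.+1) (H2 _); by rewrite (_ : t + (1 + q1 + q2) = t.+1 + q1 + q2) //; lia.
Qed.

Lemma pev_case_nil env e e1 e2 v c c1 :
  pev p env e Nil c -> pev p env e1 v c1 -> pev p env (ECase e e1 e2) v (1 + c + c1).
Proof.
move=> [q1 l1 H1] [q2 l2 H2]; exists (1 + q1 + q2) => [|t]; first by lia.
have := eval_case_nil e2 (H1 t.+1) (H2 _); by rewrite (_ : t + (1 + q1 + q2) = t.+1 + q1 + q2) //; lia.
Qed.

Lemma pev_case_cons env e e1 e2 x y v c c2 :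
  pev p env e (Cons x y) c -> pev p [:: x, y & env] e2 v c2 ->
  pev p env (ECase e e1 e2) v (1 + c + c2).
Proof.
move=> [q1 l1 H1] [q2 l2 H2]; exists (1 + q1 + q2) => [|t]; first by lia.
have := eval_case_cons e1 (H1 t.+1) (H2 _); by rewrite (_ : t + (1 + q1 + q2) = t.+1 + q1 + q2) //; lia.
Qed.

Lemma pev_let env e1 e2 v1 v2 c1 c2 :
  pev p env e1 v1 c1 -> pev p (v1 :: env) e2 v2 c2 -> pev p env (ELet e1 e2) v2 (1 + c1 + c2).
Proof.
move=> [q1 l1 H1] [q2 l2 H2]; exists (1 + q1 + q2) => [|t]; first by lia.
have := eval_let (H1 t.+1) (H2 _); by rewrite (_ : t + (1 + q1 + q2) = t.+1 + q1 + q2) //; lia.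
Qed.

Lemma pevs_nil env : pevs p env [::] [::] 0.
Proof. by exists 0 => // t; rewrite addn0; apply: evals_nil. Qed.

Lemma pevs_cons env e es v vs c1 c2 :
  pev p env e v c1 -> pevs p env es vs c2 -> pevs p env (e :: es) (v :: vs) (c1 + c2).
Proof.
move=> [q1 l1 H1] [q2 l2 H2]; exists (q1 + q2) => [|t]; first by lia.
by have := evals_cons (H1 t) (H2 _); rewrite addnA.
Qed.

Lemma pev_call env f es vs v c1 c2 :
  pevs p env es vs c1 -> pev p vs (nth ENil p f) v c2 -> pev p env (ECall f es) v (1 + c1 + c2).
Proof.
move=> [q1 l1 H1] [q2 l2 H2]; exists (1 + q1 + q2) => [|t]; first by lia.
have := eval_call (H1 t.+1) (H2 _); by rewrite (_ : t + (1 + q1 + q2) = t.+1 + q1 + q2) //; lia.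
Qed.

(** A function body sees only its arguments, so generated functions receive the whole environment;
    this list passes it on past [off] local variables. *)
Definition vars off m := [seq EVar (off + i) | i <- iota 0 m].

Lemma pevs_vars pre env : pevs p (pre ++ env) (vars (size pre) (size env)) env (size env).
Proof.
rewrite /vars; elim: env pre => [|v env IH] pre /=; first exact: pevs_nil.
apply: (pevs_cons (c1 := 1) (c2 := size env)).
  by apply: pev_var; rewrite addn0 nth_cat ltnn subnn.
have := IH (rcons pre v); rewrite size_rcons cat_rcons -[1]addn0 iotaDl -map_comp.
congr pevs; apply: eq_map => i /=; congr EVar; lia.
Qed.

End PureRules.

(* Expressions whose loops run over lists truncated to the length N of a counter,
   so that evaluation takes time polynomial in N. *)
Inductive lexp :=
  | LVar of nat
  | LNil
  | LCons of lexp & lexp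
  | LCase of lexp & lexp & lexp
  | LIf of lexp & lexp & lexp
  | LLet of lexp & lexp
  | LFold of lexp & lexp & lexp
  | LApp of lexp & seq lexp.

Fixpoint items t := if t is Cons x l then x :: items l else [::].

Fixpoint den N (env : seq tree) (e : lexp) {struct e} : tree :=
  match e with
  | LVar i => nth Nil env i
  | LNil => Nil
  | LCons e1 e2 => Cons (den N env e1) (den N env e2)
  | LCase e0 e1 e2 =>
      match den N env e0 with
      | Nil => den N env e1
      | Cons x y => den N [:: x, y & env] e2
      end
  | LIf e0 e1 e2 => if den N env e0 is Cons _ _ then den N env e1 else den N env e2
  | LLet e1 e2 => den N (den N env e1 :: env) e2
  | LFold l i b =>
      foldr (fun x acc => den N [:: x, acc & env] b) (den N env i) (take N (items (den N env l)))
  | LApp f args => den N (map (fun a => den N env a) args) f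
  end.

Section LexpInd.
Variable P : lexp -> Prop.
Hypotheses (HVar : forall i, P (LVar i)) (HNil : P LNil)
  (HCons : forall e1 e2, P e1 -> P e2 -> P (LCons e1 e2))
  (HCase : forall e e1 e2, P e -> P e1 -> P e2 -> P (LCase e e1 e2))
  (HIf : forall e e1 e2, P e -> P e1 -> P e2 -> P (LIf e e1 e2))
  (HLet : forall e1 e2, P e1 -> P e2 -> P (LLet e1 e2))
  (HFold : forall l i b, P l -> P i -> P b -> P (LFold l i b))
  (HApp : forall f args, P f -> foldr (fun a Q => P a /\ Q) True args -> P (LApp f args)).

Fixpoint lexp_nested_ind e : P e :=
  match e with
  | LVar i => HVar i
  | LNil => HNil
  | LCons e1 e2 => HCons (lexp_nested_ind e1) (lexp_nested_ind e2)
  | LCase e e1 e2 => HCase (lexp_nested_ind e) (lexp_nested_ind e1) (lexp_nested_ind e2)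
  | LIf e e1 e2 => HIf (lexp_nested_ind e) (lexp_nested_ind e1) (lexp_nested_ind e2)
  | LLet e1 e2 => HLet (lexp_nested_ind e1) (lexp_nested_ind e2)
  | LFold l i b => HFold (lexp_nested_ind l) (lexp_nested_ind i) (lexp_nested_ind b)
  | LApp f args => HApp (lexp_nested_ind f)
      ((fix all_args s : foldr (fun a Q => P a /\ Q) True s :=
          match s with
          | [::] => I
          | a :: s' => conj (lexp_nested_ind a) (all_args s')
          end) args)
  end.
End LexpInd.

Definition poly_bounded (K : nat -> nat) := exists c d, forall N, K N <= c * N.+1 ^ d.

Lemma poly_bounded_const c : poly_bounded (fun=> c).
Proof. by exists c, 0 => N; rewrite muln1. Qed.

Lemma poly_bounded_add K1 K2 : poly_bounded K1 -> poly_bounded K2 -> poly_bounded (fun N => K1 N + K2 N).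
Proof.
move=> [c1 [d1 H1]] [c2 [d2 H2]]; exists (c1 + c2), (d1 + d2) => N.
rewrite mulnDl; apply: leq_add.
  by apply: leq_trans (H1 N) _; rewrite leq_mul2l leq_pexp2l ?leq_addr ?orbT.
by apply: leq_trans (H2 N) _; rewrite leq_mul2l leq_pexp2l ?leq_addl ?orbT.
Qed.

Lemma poly_bounded_mul K1 K2 : poly_bounded K1 -> poly_bounded K2 -> poly_bounded (fun N => K1 N * K2 N).
Proof.
move=> [c1 [d1 H1]] [c2 [d2 H2]]; exists (c1 * c2), (d1 + d2) => N.
by rewrite expnD mulnACA; apply: leq_mul.
Qed.

Lemma poly_bounded_succ : poly_bounded S.
Proof. by exists 1, 1 => N; rewrite expn1 mul1n. Qed.

Definition installed (p : program) base (q : seq expr) :=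
  forall i, i < size q -> nth ENil p (base + i) = nth ENil q i.

Lemma installed_cat p base q1 q2 : installed p base (q1 ++ q2) ->
  installed p base q1 /\ installed p (base + size q1) q2.
Proof.
move=> H; split=> i lt.
  by rewrite H ?size_cat ?nth_cat ?lt //; lia.
rewrite -addnA H ?size_cat; last by lia.
by rewrite nth_cat; case: ltnP => [|_]; [lia | rewrite addKn].
Qed.

(** The counter sits at the end of the environment, so variables keep their indices. The auxiliary
    functions q of e occupy the program from position [base] on. The cost K depends only on the
    length of the counter. *)
Definition compiled (e : lexp) m base c q K :=
  forall p env cnt, installed p base q -> size env = m ->
    pev p (rcons env cnt) c (den (size (items cnt)) env e) (K (size (items cnt))).

(** The loop consumes one cell of the counter per item, so it stops even on a longer list. After
    both matches seven values precede the environment: 3 is the rest of the counter, 1 the rest of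
    the list and 6 the initial value. *)
Lemma loop_pev p m fb ff (f : tree -> tree -> tree) kb env cnt init :
  size env = m ->
  nth ENil p ff = ECase (EVar 0) (EVar 2) (ECase (EVar 3) (EVar 4)
    (ECall fb ([:: EVar 0; ECall ff ([:: EVar 3; EVar 1; EVar 6] ++ vars 7 m.+1)] ++ vars 7 m.+1))) ->
  (forall x acc, pev p ([:: x, acc & rcons env cnt]) (nth ENil p fb) (f x acc) kb) ->
  forall c l, pev p [:: c, l, init & rcons env cnt] (nth ENil p ff)
    (foldr f init (take (size (items c)) (items l))) ((size (items c)).+1 * (kb + 2 * m + 20)).
Proof.
move=> sz Eff Hb; elim=> [|x0 _ c IH] l; rewrite Eff.
  rewrite /= take0 /=; apply: (@pev_weak _ _ _ _ (1 + 1 + 1)); first by lia.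
  by apply: pev_case_nil; apply: pev_var.
rewrite [items _]/= [size _]/=.
case: l => [|x l] /=.
  apply: (@pev_weak _ _ _ _ (1 + 1 + (1 + 1 + 1))); first by nia.
  apply: pev_case_cons; first exact: pev_var.
  by apply: pev_case_nil; apply: pev_var.
have Hv pre : size pre = 7 -> pevs p (pre ++ rcons env cnt) (vars 7 m.+1) (rcons env cnt) m.+1.
  by move=> <-; rewrite -sz -(size_rcons env cnt); apply: pevs_vars.
set k := (size (items c)).+1 * (kb + 2 * m + 20) in IH *.
apply: (@pev_weak _ _ _ _ (1 + 1 + (1 + 1 + (1 + (1 + (1 + (1 + (1 + (1 + m.+1))) + k + m.+1)) + kb)))).
  rewrite [leqRHS]mulSn -/k; lia.
apply: pev_case_cons; first exact: pev_var.
apply: pev_case_cons; first exact: pev_var.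
apply: pev_call; last exact: Hb.
apply: pevs_cons; first exact: pev_var.
apply: pevs_cons; last exact: (Hv [:: x; l; x0; c; Cons x0 c; Cons x l; init]).
apply: pev_call; last exact: IH.
do 3 (apply: pevs_cons; first exact: pev_var).
exact: (Hv [:: x; l; x0; c; Cons x0 c; Cons x l; init]).
Qed.

Lemma compile e : forall m base, exists c q K, poly_bounded K /\ compiled e m base c q K.
Proof.
elim/lexp_nested_ind: e => [i||e1 e2 H1 H2|e e1 e2 H H1 H2|e e1 e2 H H1 H2|e1 e2 H1 H2|l i b Hl Hi Hb|f args Hf Ha] m base.
(* Index m would read the counter, whereas [den] yields Nil outside the environment. *)
- exists (if i < m then EVar i else ENil), [::], (fun=> 1); split; first exact: poly_bounded_const.
  move=> p env cnt _ sz /=; case: ltnP => lt.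
    by apply: pev_var; rewrite nth_rcons sz lt.
  by rewrite nth_default ?sz //; apply: pev_nil.
- exists ENil, [::], (fun=> 1); split; first exact: poly_bounded_const.
  by move=> p env cnt _ _; apply: pev_nil.
- have [c1 [q1 [K1 [P1 C1]]]] := H1 m base.
  have [c2 [q2 [K2 [P2 C2]]]] := H2 m (base + size q1).
  exists (ECons c1 c2), (q1 ++ q2), (fun N => 1 + K1 N + K2 N); split.
    by do !apply: poly_bounded_add => //; apply: poly_bounded_const.
  move=> p env cnt /installed_cat[I1 I2] sz; apply: pev_cons; [exact: C1|exact: C2].
- have [c0 [q0 [K0 [P0 C0]]]] := H m base.
  have [c1 [q1 [K1 [P1 C1]]]] := H1 m (base + size q0).
  have [c2 [q2 [K2 [P2 C2]]]] := H2 m.+2 (base + size q0 + size q1).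
  exists (ECase c0 c1 c2), (q0 ++ q1 ++ q2), (fun N => 1 + K0 N + (K1 N + K2 N)); split.
    by do !apply: poly_bounded_add => //; apply: poly_bounded_const.
  move=> p env cnt /installed_cat[I0 /installed_cat[I1 I2]] sz /=.
  have := C0 p env cnt I0 sz; case: (den _ env e) => [|x y] E0.
    by apply: pev_case_nil E0 _; apply: pev_weak (C1 p env cnt I1 sz); apply: leq_addr.
  apply: pev_case_cons E0 _; apply: pev_weak (C2 p [:: x, y & env] cnt I2 _); rewrite ?leq_addl //=.
  by rewrite sz.
- have [c0 [q0 [K0 [P0 C0]]]] := H m base.
  have [c1 [q1 [K1 [P1 C1]]]] := H1 m (base + size q0).
  have [c2 [q2 [K2 [P2 C2]]]] := H2 m (base + size q0 + size q1).
  (* The target match binds two variables that the branch c1 does not expect, so c1 becomes a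
     function called with the original environment. *)
  exists (ECase c0 c2 (ECall (base + size q0 + size q1 + size q2) (vars 2 m.+1))),
    (q0 ++ q1 ++ q2 ++ [:: c1]), (fun N => 1 + K0 N + (1 + m.+1 + K1 N + K2 N)); split.
    by do !apply: poly_bounded_add => //; apply: poly_bounded_const.
  move=> p env cnt /installed_cat[I0 /installed_cat[I1 /installed_cat[I2 I3]]] sz /=.
  have := C0 p env cnt I0 sz; case: (den _ env e) => [|x y] E0.
    by apply: pev_case_nil E0 _; apply: pev_weak (C2 p env cnt I2 sz); apply: leq_addl.
  apply: pev_case_cons E0 _; apply: (pev_weak (leq_addr _ _)).
  have := I3 0 isT; rewrite addn0 /= => E3.
  apply: pev_call; last by rewrite E3; apply: C1.
  have := pevs_vars p [:: x; y] (rcons env cnt); by rewrite size_rcons sz.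
- have [c1 [q1 [K1 [P1 C1]]]] := H1 m base.
  have [c2 [q2 [K2 [P2 C2]]]] := H2 m.+1 (base + size q1).
  exists (ELet c1 c2), (q1 ++ q2), (fun N => 1 + K1 N + K2 N); split.
    by do !apply: poly_bounded_add => //; apply: poly_bounded_const.
  move=> p env cnt /installed_cat[I1 I2] sz; apply: pev_let; first exact: C1.
  by apply: (C2 p (_ :: env)); rewrite //= sz.
- have [cl [ql [Kl [Pl Cl]]]] := Hl m base.
  have [ci [qi [Ki [Pi Ci]]]] := Hi m (base + size ql).
  have [cb [qb [Kb [Pb Cb]]]] := Hb m.+2 (base + size ql + size qi).
  pose fb := base + size ql + size qi + size qb.
  pose loop := ECase (EVar 0) (EVar 2) (ECase (EVar 3) (EVar 4)
    (ECall fb ([:: EVar 0; ECall fb.+1 ([:: EVar 3; EVar 1; EVar 6] ++ vars 7 m.+1)] ++ vars 7 m.+1))).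
  exists (ECall fb.+1 ([:: EVar m; cl; ci] ++ vars 0 m.+1)), (ql ++ qi ++ qb ++ [:: cb; loop]),
    (fun N => 1 + (1 + (Kl N + (Ki N + m.+1))) + N.+1 * (Kb N + 2 * m + 20)); split.
    have P1 := poly_bounded_const 1; have Pm := poly_bounded_const m.+1.
    have Pm2 := poly_bounded_const (2 * m); have P20 := poly_bounded_const 20.
    apply: poly_bounded_add; last first.
      by apply: poly_bounded_mul poly_bounded_succ _; do !apply: poly_bounded_add => //.
    by do !apply: poly_bounded_add => //.
  move=> p env cnt /installed_cat[Il /installed_cat[Ii /installed_cat[Ib I]]] sz /=.
  have := I 0 isT; rewrite addn0 -/fb /= => Efb.
  have := I 1 isT; rewrite addn1 -/fb /= => Eff.
  set N := size (items cnt).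
  have HB x acc : pev p [:: x, acc & rcons env cnt] (nth ENil p fb) (den N [:: x, acc & env] b) (Kb N).
    by rewrite Efb; apply: (Cb p [:: x, acc & env]); rewrite //= sz.
  apply: pev_call; last exact: (loop_pev (den N env i) sz Eff HB).
  apply: pevs_cons; first by apply: pev_var; rewrite nth_rcons sz ltnn eqxx.
  apply: pevs_cons; first exact: Cl.
  apply: pevs_cons; first exact: Ci.
  by have := pevs_vars p [::] (rcons env cnt); rewrite size_rcons sz.
- have [cf [qf [Kf [Pf Cf]]]] := Hf (size args) base.
  have {Hf} [cs [q [K [PK CK]]]] : exists cs q K, poly_bounded K /\
      forall p env cnt, installed p (base + size qf) q -> size env = m ->
      pevs p (rcons env cnt) cs (rcons (map (den (size (items cnt)) env) args) cnt)
        (K (size (items cnt))).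
    elim: args Ha (base + size qf) {Cf} => [|a args IH] /= Ha base'.
      exists [:: EVar m], [::], (fun=> 1 + 0); split; first exact: poly_bounded_const.
      move=> p env cnt _ sz; apply: pevs_cons; last exact: pevs_nil.
      by apply: pev_var; rewrite nth_rcons sz ltnn eqxx.
    case: Ha => Ha Hargs; have [c1 [q1 [K1 [P1 C1]]]] := Ha m base'.
    have [cs [q [K [PK CK]]]] := IH Hargs (base' + size q1).
    exists (c1 :: cs), (q1 ++ q), (fun N => K1 N + K N); split; first exact: poly_bounded_add.
    move=> p env cnt /installed_cat[I1 I2] sz; apply: pevs_cons; [exact: C1 | exact: CK].
  exists (ECall (base + size qf + size q) cs), (qf ++ q ++ [:: cf]), (fun N => 1 + K N + Kf N); split.
    by do !apply: poly_bounded_add => //; apply: poly_bounded_const.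
  move=> p env cnt /installed_cat[If /installed_cat[Iq I]] sz.
  have := I 0 isT; rewrite addn0 /= => E.
  apply: pev_call; first exact: CK.
  by rewrite E; apply: Cf; rewrite ?size_map.
Qed.

(** * Code for tables, quantifiers and flows *)

Lemma enc_natE m : enc_nat m = enc_seq (nseq m Nil).
Proof. by elim: m => //= m ->. Qed.

Lemma itemsK s : items (enc_seq s) = s.
Proof. by elim: s => //= x s ->. Qed.

Definition enc_tab m (f : 'I_m -> tree) := enc_seq [seq f i | i <- enum 'I_m].
Definition enc_idx m := enc_tab (fun i : 'I_m => enc_nat i).
Definition enc_rel m (D : rel 'I_m) := enc_tab (fun i => enc_tab (fun j => enc_bool (D i j))).

Lemma nth_tab m (f : 'I_m -> tree) (i : 'I_m) : nth Nil [seq f j | j <- enum 'I_m] i = f i.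
Proof. by rewrite (nth_map i) ?size_enum_ord // nth_ord_enum. Qed.

Definition nonnil t := if t is Cons _ _ then true else false.

Definition lTrue := LCons LNil LNil.
Definition lNot e := LIf e LNil lTrue.
Definition lAnd e1 e2 := LIf e1 e2 LNil.
Definition lOr e1 e2 := LIf e1 lTrue e2.
(** A loop body sees the current element as variable 0 and the accumulator as variable 1, so each
    enclosing loop shifts the outer indices by two. *)
Definition lTab idx body := LFold idx LNil (LCons body (LVar 1)).
Definition lEx idx body := LFold idx LNil (LIf body lTrue (LVar 1)).

Lemma foldr_cons A B (f : A -> B -> B) z x s : foldr f z (x :: s) = f x (foldr f z s).
Proof. by []. Qed.

Section Den.
Variables (N : nat).

Lemma den_fold env l i b s : den N env l = enc_seq s -> size s <= N ->
  den N env (LFold l i b) = foldr (fun x acc => den N [:: x, acc & env] b) (den N env i) s.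
Proof. by move=> /= -> sz; rewrite itemsK take_oversize. Qed.

Lemma den_app1 env f a : den N env (LApp f [:: a]) = den N [:: den N env a] f.
Proof. by []. Qed.

Lemma den_app2 env f a b :
  den N env (LApp f [:: a; b]) = den N [:: den N env a; den N env b] f.
Proof. by []. Qed.

Lemma den_cons env e e1 e2 x y : den N env e = Cons x y ->
  den N env (LCase e e1 e2) = den N [:: x, y & env] e2.
Proof. by move=> /= ->. Qed.

Lemma den_pair env e1 e2 : den N env (LCons e1 e2) = Cons (den N env e1) (den N env e2).
Proof. by []. Qed.

Lemma den_let env e1 e2 v r : den N env e1 = v -> den N (v :: env) e2 = r ->
  den N env (LLet e1 e2) = r.
Proof. by move=> <-. Qed.

Lemma den_if env e e1 e2 x : den N env e = enc_bool x ->
  den N env (LIf e e1 e2) = if x then den N env e1 else den N env e2.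
Proof. by move=> /= ->; case: x. Qed.

Lemma den_not env e x : den N env e = enc_bool x -> den N env (lNot e) = enc_bool (~~ x).
Proof. by move=> /den_if->; case: x. Qed.

Lemma den_and env e1 e2 x y : den N env e1 = enc_bool x -> den N env e2 = enc_bool y ->
  den N env (lAnd e1 e2) = enc_bool (x && y).
Proof. by move=> /den_if-> ->; case: x. Qed.

Lemma den_or env e1 e2 x y : den N env e1 = enc_bool x -> den N env e2 = enc_bool y ->
  den N env (lOr e1 e2) = enc_bool (x || y).
Proof. by move=> /den_if-> ->; case: x. Qed.

Lemma den_fold_tab m (f : 'I_m -> tree) env l i b : den N env l = enc_tab f -> m <= N ->
  den N env (LFold l i b) =
  foldr (fun x acc => den N [:: f x, acc & env] b) (den N env i) (enum 'I_m).
Proof.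
move=> Hl le; rewrite (@den_fold _ _ _ _ [seq f i | i <- enum 'I_m]) //.
  by elim: (enum 'I_m) => //= x s ->.
by rewrite size_map size_enum_ord.
Qed.

Lemma den_tab m (f : 'I_m -> tree) env idx body : m <= N -> den N env idx = enc_idx m ->
  (forall (i : 'I_m) acc, den N [:: enc_nat i, acc & env] body = f i) ->
  den N env (lTab idx body) = enc_tab f.
Proof.
move=> le Hidx Hb; rewrite (den_fold_tab _ _ Hidx) //.
by rewrite /enc_tab; elim: (enum 'I_m) => //= i s ->; rewrite Hb.
Qed.

Lemma den_ex m (P : pred 'I_m) env idx body : m <= N -> den N env idx = enc_idx m ->
  (forall (i : 'I_m) acc, den N [:: enc_nat i, acc & env] body = enc_bool (P i)) ->
  den N env (lEx idx body) = enc_bool [exists i, P i].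
Proof.
move=> le Hidx Hb; rewrite (den_fold_tab _ _ Hidx) //.
transitivity (enc_bool (has P (enum 'I_m))).
  elim: (enum 'I_m) => //= i s ->; rewrite Hb.
  by case: (P i).
congr enc_bool; apply/hasP/existsP=> [[i _]|[i]]; first by exists i.
by exists i; rewrite ?mem_enum.
Qed.

Lemma den_iter (A : Type) (enc : A -> tree) (f : A -> A) env l i b s q a :
  den N env l = enc_seq s -> size s = q -> q <= N -> den N env i = enc a ->
  (forall x a', den N [:: x, enc a' & env] b = enc (f a')) ->
  den N env (LFold l i b) = enc (iter q f a).
Proof.
move=> Hl <- sz Hi Hb; rewrite (den_fold _ _ Hl sz) Hi {Hl sz}.
by elim: s => //= x s ->.
Qed.

(** Removes from the second list as many items as the first one has. On unary numbers this is
    truncated subtraction; indexing and comparison are derived from it. *)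
Definition lDrop := LFold (LVar 0) (LVar 1) (LCase (LVar 1) LNil (LVar 1)).

Lemma lDropE s s' : size s <= N ->
  den N [:: enc_seq s; enc_seq s'] lDrop = enc_seq (drop (size s) s').
Proof.
move=> sz; rewrite (den_fold _ _ (s := s)) //= {sz}.
elim: s => [|x s IH] /=; first by rewrite drop0.
by rewrite IH -add1n -drop_drop; case: (drop _ _) => //= y l; rewrite drop0.
Qed.

Definition lNth := LCase (LApp lDrop [:: LVar 1; LVar 0]) LNil (LVar 0).

Lemma lNthE s i : i <= N -> den N [:: enc_seq s; enc_nat i] lNth = nth Nil s i.
Proof.
move=> le; have := @lDropE (nseq i Nil) s; rewrite size_nseq -enc_natE => /(_ le).
rewrite /lNth /= => ->; rewrite -[X in nth _ _ X]addn0 -nth_drop; by case: (drop i s).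
Qed.

Definition lGet l i := LApp lNth [:: l; i].

Lemma den_get m (f : 'I_m -> tree) (i : 'I_m) env l e : m <= N ->
  den N env l = enc_tab f -> den N env e = enc_nat i -> den N env (lGet l e) = f i.
Proof.
move=> le El Ee; rewrite /lGet den_app2 El Ee.
rewrite lNthE ?nth_tab //; have := ltn_ord i; lia.
Qed.

Definition lLt := LIf (LApp lDrop [:: LVar 0; LVar 1]) lTrue LNil.

Lemma lLtE s s' : size s <= N -> den N [:: enc_seq s; enc_seq s'] lLt = enc_bool (size s < size s').
Proof.
move=> sz; have := lDropE s' sz; rewrite /lLt /= => ->.
by have := size_drop (size s) s'; case: (drop _ _) => [|y l] /=; case: ltnP => //; lia.
Qed.

Definition lEqn i j := lNot (lOr (LApp lLt [:: i; j]) (LApp lLt [:: j; i])).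

Lemma den_eqn (m : nat) (i j : 'I_m) env e1 e2 : m <= N ->
  den N env e1 = enc_nat i -> den N env e2 = enc_nat j -> den N env (lEqn e1 e2) = enc_bool (i == j).
Proof.
move=> le E1 E2.
have lt (u v : 'I_m) : den N [:: enc_nat u; enc_nat v] lLt = enc_bool (u < v).
  by rewrite !enc_natE lLtE size_nseq ?size_nseq //; have := ltn_ord u; lia.
have -> : (i == j) = ~~ ((i < j) || (j < i)) by rewrite -neq_ltn negbK.
by apply: den_not; apply: den_or; rewrite den_app2 E1 E2.
Qed.

Definition lIdx := LFold (LVar 0) LNil
  (LCons LNil (LFold (LVar 1) LNil (LCons (LCons LNil (LVar 0)) (LVar 1)))).

Lemma lIdxE s m : size s = m -> m <= N -> den N [:: enc_seq s] lIdx = enc_idx m.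
Proof.
move=> <- sz.
have -> : enc_idx (size s) = enc_seq [seq enc_nat i | i <- iota 0 (size s)].
  by rewrite /enc_idx /enc_tab -val_enum_ord -map_comp.
rewrite (den_fold _ _ (s := s)) //.
elim: s sz => // x s IH /= sz; rewrite IH ?(ltnW sz) // itemsK.
rewrite take_oversize ?size_map ?size_iota ?(ltnW sz) // -[1]addn0 iotaDl -map_comp.
by congr Cons; elim: (iota _ _) => //= y l ->.
Qed.

Definition lRel D i j := lGet (lGet D i) j.

Lemma den_rel m (D : rel 'I_m) (i j : 'I_m) env l e1 e2 : m <= N ->
  den N env l = enc_rel D -> den N env e1 = enc_nat i -> den N env e2 = enc_nat j ->
  den N env (lRel l e1 e2) = enc_bool (D i j).
Proof.
move=> le El E1 E2; apply: (den_get (f := fun j => enc_bool (D i j))) E2 => //.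
exact: (den_get (f := fun i => enc_tab (fun j => enc_bool (D i j)))) E1.
Qed.

Lemma den_mem m (S : {set 'I_m}) (i : 'I_m) env l e : m <= N ->
  den N env l = enc_set S -> den N env e = enc_nat i ->
  den N env (lGet l e) = enc_bool (i \in S).
Proof. by move=> le El Ee; apply: (den_get (f := fun i => enc_bool (i \in S))) Ee. Qed.

Lemma den_set m (S : {set 'I_m}) env idx body : m <= N -> den N env idx = enc_idx m ->
  (forall (i : 'I_m) acc, den N [:: enc_nat i, acc & env] body = enc_bool (i \in S)) ->
  den N env (lTab idx body) = enc_set S.
Proof. exact: den_tab. Qed.

Definition lNbr := lTab (LVar 2) (lAnd (lNot (lGet (LVar 3) (LVar 0)))
  (lEx (LVar 4) (lAnd (lGet (LVar 5) (LVar 0)) (lRel (LVar 4) (LVar 0) (LVar 2))))).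

Lemma lNbrE m (G : sgraph 'I_m) A : m <= N ->
  den N [:: enc_graph G; enc_set A; enc_idx m] lNbr = enc_set (nbr G A).
Proof.
move=> le; apply: den_set => // v acc; rewrite inE.
apply: den_and; first by apply: den_not; apply: den_mem.
by apply: den_ex => // u acc'; apply: den_and; [apply: den_mem | apply: den_rel].
Qed.

Definition lDisj := lNot (lEx (LVar 2) (lAnd (lGet (LVar 2) (LVar 0)) (lGet (LVar 3) (LVar 0)))).

Lemma lDisjE m (A B : {set 'I_m}) : m <= N ->
  den N [:: enc_set A; enc_set B; enc_idx m] lDisj = enc_bool [disjoint A & B].
Proof.
move=> le; have -> : [disjoint A & B] = ~~ [exists i, (i \in A) && (i \in B)].
  apply/pred0P/existsPn => H i; first by have /= -> := H i.
  by apply/negbTE; apply: H.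
by apply: den_not; apply: den_ex => // i acc; apply: den_and; apply: den_mem.
Qed.

(** * Code of the augmenting-path search *)

Section SearchCode.
Variable m : nat.
Hypothesis mN : m <= N.
Implicit Types (D : rel 'I_m) (l : seq ('I_m * 'I_m)) (X Z : {set 'I_m}).
Implicit Types (P : 'I_m -> option (seq ('I_m * 'I_m))) (i j u w z : 'I_m).

Definition enc_arc (e : 'I_m * 'I_m) := Cons (enc_nat e.1) (enc_nat e.2).
Definition enc_path (o : option (seq ('I_m * 'I_m))) :=
  if o is Some l then Cons Nil (enc_seq [seq enc_arc e | e <- l]) else Nil.
Definition enc_paths P := enc_tab (fun i => enc_path (P i)).

Definition lExtend := LFold (LVar 2) LNil (LCase (lGet (LVar 3) (LVar 0)) (LVar 1)
  (LIf (lRel (LVar 4) (LVar 2) (LVar 7))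
     (LCons LNil (LCons (LCons (LVar 2) (LVar 7)) (LVar 1))) (LVar 3))).

Lemma den_case_path env e e1 e2 o : den N env e = enc_path o ->
  den N env (LCase e e1 e2) =
  if o is Some l then den N [:: Nil, enc_seq [seq enc_arc e | e <- l] & env] e2 else den N env e1.
Proof. by move=> /= ->; case: o. Qed.

Lemma lExtendE D P j :
  den N [:: enc_rel D; enc_paths P; enc_idx m; enc_nat j] lExtend = enc_path (extend D P j).
Proof.
rewrite /lExtend (den_fold_tab (f := fun i : 'I_m => enc_nat i)) // /extend.
elim: (enum 'I_m) => // i s IH; rewrite [LHS]foldr_cons IH [in RHS]/=; cbv beta.
rewrite (den_case_path _ _ (o := P i)); last exact: (den_get (f := fun i => enc_path (P i))).
case: (P i) => // l.
by rewrite (den_if _ _ (x := D i j)); [case: (D i j) | apply: den_rel].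
Qed.

Definition lStep := lTab (LVar 2) (LCase (lGet (LVar 3) (LVar 0))
  (LApp lExtend [:: LVar 2; LVar 3; LVar 4; LVar 0]) (LCons (LVar 0) (LVar 1))).

Lemma lStepE D P : den N [:: enc_rel D; enc_paths P; enc_idx m] lStep = enc_paths (search_step D P).
Proof.
apply: den_tab => // j acc; rewrite (den_case_path _ _ (o := P j)) /search_step.
  by case: (P j) => // ; apply: lExtendE.
exact: (den_get (f := fun i => enc_path (P i))).
Qed.

Definition lSearch := LFold (LVar 2)
  (lTab (LVar 2) (LIf (lGet (LVar 3) (LVar 0)) (LCons LNil LNil) LNil))
  (LApp lStep [:: LVar 2; LVar 1; LVar 4]).

Lemma lSearchE D X : den N [:: enc_rel D; enc_set X; enc_idx m] lSearch = enc_paths (search D X).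
Proof.
apply: (den_iter (s := [seq enc_nat (val i) | i <- enum 'I_m])) => //.
- by rewrite size_map cardE.
- by rewrite card_ord.
- apply: den_tab => // j acc; rewrite (den_if _ _ (x := j \in X)); last exact: den_mem.
  by rewrite /search0; case: (j \in X).
- by move=> x P; apply: lStepE.
Qed.

Definition lKnown := lTab (LVar 1) (LIf (lGet (LVar 2) (LVar 0)) lTrue LNil).

Lemma den_known env e P i : den N env e = enc_path (P i) ->
  den N env (LIf e lTrue LNil) = enc_bool (i \in known P).
Proof. by move=> /= ->; rewrite inE; case: (P i). Qed.

Lemma lKnownE P : den N [:: enc_paths P; enc_idx m] lKnown = enc_set (known P).
Proof.
apply: den_set => // i acc; apply: den_known.
exact: (den_get (f := fun i => enc_path (P i))).
Qed.

Definition lReverse := lTab (LVar 3) (lTab (LVar 5)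
  (LIf (lAnd (lEqn (LVar 2) (LVar 5)) (lEqn (LVar 0) (LVar 6))) LNil
  (LIf (lAnd (lEqn (LVar 2) (LVar 6)) (lEqn (LVar 0) (LVar 5))) lTrue
  (lRel (LVar 4) (LVar 2) (LVar 0))))).

Lemma lReverseE D u w : den N [:: enc_rel D; enc_nat u; enc_nat w; enc_idx m] lReverse =
  enc_rel (reverse_arc D (u, w)).
Proof.
apply: den_tab => // x acc; apply: den_tab => // y acc'; rewrite /reverse_arc [in RHS]/=.
rewrite (den_if _ _ (x := (x == u) && (y == w))); last by apply: den_and; apply: den_eqn.
case: ifP => // _.
rewrite (den_if _ _ (x := (x == w) && (y == u))); last by apply: den_and; apply: den_eqn.
by case: ifP => // _; apply: den_rel.
Qed.

Definition lReverses := LFold (LVar 1) (LVar 0)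
  (LCase (LVar 0) LNil (LApp lReverse [:: LVar 3; LVar 0; LVar 1; LVar 6])).

Lemma lReversesE D l : size l <= N ->
  den N [:: enc_rel D; enc_seq [seq enc_arc e | e <- l]; enc_idx m] lReverses =
  enc_rel (reverse_arcs D l).
Proof.
move=> sz; rewrite (den_fold _ _ (s := [seq enc_arc e | e <- l])) ?size_map //.
elim: l {sz} => // -[u w] l IH.
by rewrite [map _ _]/= [foldr _ _ _]/= IH; apply: (lReverseE (reverse_arcs D l)).
Qed.

(** Each round lengthens paths by at most one arc. The bound ensures that the loop reversing a path
    is not cut off by the counter. *)
Lemma size_search D X j l : search D X j = Some l -> size l <= m.
Proof.
rewrite /search -[X in _ <= X]card_ord; elim: #|_| j l => [|q IH] j l.
  by rewrite /= /search0; case: ifP => // _ [<-].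
rewrite iterS; set P := iter q _ _ in IH *; rewrite /search_step.
case Pj: (P j) => [l0|]; first by case=> <-; apply: leq_trans (IH _ _ Pj) _.
by have [[i [l0 [/IH ? _ ->]]] [<-]|[-> //]] := extendP D P j.
Qed.

Definition lAugment := LLet (LApp lSearch [:: LVar 0; LVar 1; LVar 3])
  (LFold (LVar 4) (LVar 1) (LIf (lGet (LVar 5) (LVar 0))
    (LCase (lGet (LVar 2) (LVar 0)) (LVar 1) (LApp lReverses [:: LVar 5; LVar 1; LVar 8]))
    (LVar 1))).

Lemma lAugmentE D X Z : den N [:: enc_rel D; enc_set X; enc_set Z; enc_idx m] lAugment =
  enc_rel (augment X Z D).
Proof.
apply: den_let; first exact: lSearchE.
rewrite (den_fold_tab (f := fun i : 'I_m => enc_nat i)) //.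
rewrite /augment; elim: (enum 'I_m) => // z s IH; rewrite [LHS]foldr_cons IH [in RHS]/=; cbv beta.
rewrite (den_if _ _ (x := z \in Z)); last exact: den_mem.
case: ifP => // _; rewrite (den_case_path _ _ (o := search D X z)); last first.
  exact: (den_get (f := fun i => enc_path (search D X i))).
case E: (search D X z) => [l|] //; apply: lReversesE.
exact: leq_trans (size_search E) mN.
Qed.

End SearchCode.
End Den.

(** * Tries *)

(** A key is read from its last bit to its first, the order in which a fold meets the bits; a key is
    present when a nonempty tree is reached. *)
Definition tget (t : tree) (s : seq bool) :=
  foldr (fun (x : bool) t => match t with Nil => Nil | Cons l r => if x then r else l end) t s.

Definition tmem t s := nonnil (tget t s).

(** With folds as the only loops, insertion takes two passes, as with a zipper: the way down records
    the siblings off the path, deepest last, and [tup] rebuilds the tree from the bottom. *)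
Definition tdown (x : bool) (acc : tree * seq (bool * tree)) :=
  match acc.1 with
  | Nil => (Nil, rcons acc.2 (x, Nil))
  | Cons l r => if x then (r, rcons acc.2 (x, l)) else (l, rcons acc.2 (x, r))
  end.

Definition tup (e : bool * tree) t := if e.1 then Cons e.2 t else Cons t e.2.

Definition tins t s := foldr tup (Cons Nil Nil) (foldr tdown (t, [::]) s).2.

Lemma tmem_nil s : tmem Nil s = false.
Proof. by rewrite /tmem /tget; elim: s => //= x s; case: (foldr _ _ _). Qed.

Lemma foldr_rev A B (f : A -> B -> B) z s : foldr f z (rev s) = foldl (fun z x => f x z) z s.
Proof. by rewrite -[in RHS](revK s) foldl_rev. Qed.

Lemma tmem_ins t s s' : size s' = size s -> tmem (tins t s) s' = (s' == s) || tmem t s'.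
Proof.
(* Keys are reversed so that the induction follows the trie from its root. *)
rewrite -[s]revK -[s']revK (inj_eq (can_inj (@revK _))) ![size (rev (rev _))]size_rev.
elim: (rev s) t (rev s') => [|x r IH] t [|y r'] //; case=> sz.
pose child t (x : bool) := match t with Nil => Nil | Cons l r => if x then r else l end.
have getE u z q : tmem u (rev (z :: q)) = tmem (child u z) (rev q).
  by rewrite /tmem /tget !foldr_rev.
have insE u z q : tins u (rev (z :: q)) = tup (z, child u (~~ z)) (tins (child u z) (rev q)).
  rewrite /tins !foldr_rev /=.
  have acc v w l : foldr tup v (foldl (fun a b => tdown b a) (w, l) q).2 =
      foldr tup (foldr tup v (foldl (fun a b => tdown b a) (w, [::]) q).2) l.
    elim: q w l => //= z' q IHq w l.
    by rewrite /tdown /=; case: w => [|w1 w2]; [|case: z'];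
       rewrite IHq [in RHS]IHq /= -cats1 foldr_cat.
  by rewrite /tdown /=; case: u => [|u1 u2]; [|case: z]; rewrite acc.
rewrite insE !getE eqseq_cons; have := IH (child t x) r' sz.
case: x y => -[] //= _; by case: t.
Qed.

Definition enc_item (e : bool * tree) := Cons (enc_bool e.1) e.2.
Definition enc_bits (s : seq bool) := enc_seq [seq enc_bool x | x <- s].
Definition set_key n (S : {set 'I_n}) := [seq i \in S | i <- enum 'I_n].
Definition enc_sets n (Ss : seq {set 'I_n}) := enc_seq [seq enc_set X | X <- Ss].

Lemma enc_set_key n (S : {set 'I_n}) : enc_set S = enc_bits (set_key S).
Proof. by rewrite /enc_bits -map_comp. Qed.

Lemma size_set_key n (S : {set 'I_n}) : size (set_key S) = n.
Proof. by rewrite size_map size_enum_ord. Qed.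

Lemma set_key_inj n : injective (@set_key n).
Proof.
by move=> X Y /eq_in_map E; apply/setP=> i; rewrite E ?mem_enum.
Qed.

Section TrieCode.
Variable N : nat.

Definition lSnoc := LFold (LVar 0) (LCons (LVar 1) LNil) (LCons (LVar 0) (LVar 1)).

Lemma lSnocE s x : size s <= N -> den N [:: enc_seq s; x] lSnoc = enc_seq (rcons s x).
Proof. by move=> sz; rewrite (den_fold _ _ (s := s)) //; elim: s {sz} => //= y s ->. Qed.

Local Opaque lSnoc.

Definition lTget := LFold (LVar 1) (LVar 0)
  (LCase (LVar 1) LNil (LIf (LVar 2) (LVar 1) (LVar 0))).

Lemma lTgetE t s : size s <= N -> den N [:: t; enc_bits s] lTget = tget t s.
Proof.
move=> sz; rewrite (den_fold _ _ (s := [seq enc_bool x | x <- s])) ?size_map //.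
by elim: s {sz} => //= x s ->; case: (tget t s) => //= l r; case: x.
Qed.

Definition lTmem := LIf (LApp lTget [:: LVar 0; LVar 1]) lTrue LNil.

Lemma lTmemE t s : size s <= N -> den N [:: t; enc_bits s] lTmem = enc_bool (tmem t s).
Proof.
move=> sz; have := lTgetE t sz; rewrite /tmem.
rewrite -[LHS]/(den N [:: t; enc_bits s] (LApp lTget [:: LVar 0; LVar 1])).
by move=> /= ->; case: (tget t s).
Qed.

Definition lTdown := LFold (LVar 1) (LCons (LVar 0) LNil)
  (LCase (LVar 1) LNil (LCase (LVar 0)
    (LCons LNil (LApp lSnoc [:: LVar 1; LCons (LVar 2) LNil]))
    (LIf (LVar 4) (LCons (LVar 1) (LApp lSnoc [:: LVar 3; LCons (LVar 4) (LVar 0)]))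
                  (LCons (LVar 0) (LApp lSnoc [:: LVar 3; LCons (LVar 4) (LVar 1)]))))).

Lemma size_tdown t s : size (foldr tdown (t, [::]) s).2 = size s.
Proof.
elim: s => //= x s <-; rewrite {1}/tdown.
by case: (foldr _ _ _) => -[|l r] q /=; [|case: x]; rewrite size_rcons.
Qed.

Lemma lTdownE t s : size s <= N -> den N [:: t; enc_bits s] lTdown =
  let r := foldr tdown (t, [::]) s in Cons r.1 (enc_seq [seq enc_item e | e <- r.2]).
Proof.
move=> sz; rewrite (den_fold _ _ (s := [seq enc_bool x | x <- s])) ?size_map //.
elim: s sz => // x s IH sz; rewrite [map _ _]/= [LHS]foldr_cons IH ?(ltnW sz) //.
rewrite [in RHS]/=; have := size_tdown t s.
case: (foldr tdown _ s) => t' q /= szq; rewrite /tdown /=.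
have sq : size [seq enc_item e | e <- q] <= N by rewrite size_map szq ltnW.
case: t' => [|l r] /=; first by rewrite (lSnocE _ sq) map_rcons.
by case: x sz => sz /=; rewrite (lSnocE _ sq) map_rcons.
Qed.

Definition lTins := LFold (LCase (LApp lTdown [:: LVar 0; LVar 1]) LNil (LVar 1)) lTrue
  (LCase (LVar 0) LNil (LIf (LVar 0) (LCons (LVar 1) (LVar 3)) (LCons (LVar 3) (LVar 1)))).

Lemma lTinsE t s : size s <= N -> den N [:: t; enc_bits s] lTins = tins t s.
Proof.
move=> sz; have D := lTdownE t sz.
rewrite (den_fold _ _ (s := [seq enc_item e | e <- (foldr tdown (t, [::]) s).2])).
- by rewrite /tins; elim: (foldr _ _ _).2 => //= -[x t'] q -> /=; case: x.
- exact: (den_cons (e := LApp lTdown [:: LVar 0; LVar 1]) _ _ D).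
- by rewrite size_map size_tdown.
Qed.

End TrieCode.

(** * One step of the enumeration *)

Record state n := State {
  source : {set 'I_n};
  pending : seq {set 'I_n};
  visited : tree;
  tasks : seq {set 'I_n};
  found : tree
}.

Section Step.
Variables (n : nat) (G : sgraph 'I_n) (b : 'I_n) (K : nat).
Implicit Types (X Y A B C : {set 'I_n}).

Definition add_each A B := [seq v |: B | v <- enum 'I_n & v \in A].

(** A cut found in an earlier task must still be expanded in the current one, but neither output nor
    turned into tasks again; hence the two tries [vis] and [fnd]. *)
Definition step (st : state n) : option (state n * option {set 'I_n}) :=
  let: State X pend vis tsk fnd := st in
  match pend with
  | [::] => if tsk is X' :: tsk' then Some (State X' [:: [set b]] Nil tsk' fnd, None) else None
  | Y :: pend' =>
    let A := cut G X Y in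
    let C := nbr G A in
    if [&& [disjoint A & Y], [disjoint C & Y] & #|C| < K] && ~~ tmem vis (set_key C) then
      let pend'' := add_each C (cmp G C b) ++ pend' in
      let vis' := tins vis (set_key C) in
      if tmem fnd (set_key C) then Some (State X pend'' vis' tsk fnd, None)
      else Some (State X pend'' vis' (add_each C A ++ tsk) (tins fnd (set_key C)), Some C)
    else Some (State X pend' vis tsk fnd, None)
  end.

Definition enc_state (st : state n) :=
  let: State X pend vis tsk fnd := st in
  Cons (enc_graph G) (Cons (enc_set [set b]) (Cons (enc_nat K) (Cons (enc_set X)
    (Cons (enc_sets pend) (Cons vis (Cons (enc_sets tsk) fnd)))))).

Definition enc_step (r : option (state n * option {set 'I_n})) :=
  if r is Some (st, o) then
    Cons (enc_state st) (if o is Some C then Cons (enc_set C) Nil else Nil)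
  else Nil.

End Step.

(** * Code of one step, with a counter of length at least 2n for the split digraph *)

Section StepCode.
Variables (N n : nat).
Hypothesis nN : n + n <= N.
Let nN1 : n <= N. Proof. exact: leq_trans (leq_addr n n) nN. Qed.
Implicit Types (X Y Z A B C : {set 'I_n}) (G : sgraph 'I_n).

Lemma enc_idx_seq : exists2 s, size s = n & enc_idx n = enc_seq s.
Proof. by exists [seq enc_nat (val i) | i <- enum 'I_n]; rewrite // size_map size_enum_ord. Qed.

Lemma lt_idx (i : 'I_(n + n)) : den N [:: enc_nat i; enc_idx n] lLt = enc_bool (i < n).
Proof.
have [s sz ->] := enc_idx_seq; rewrite enc_natE lLtE size_nseq ?sz //.
exact: ltnW (leq_trans (ltn_ord i) nN).
Qed.

Lemma sub_idx i : den N [:: enc_idx n; enc_nat i] lDrop = enc_nat (i - n).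
Proof.
by have [s sz ->] := enc_idx_seq; rewrite enc_natE lDropE sz // drop_nseq -enc_natE.
Qed.

Definition lAppend := LFold (LVar 0) (LVar 1) (LCons (LVar 0) (LVar 1)).

Lemma lAppendE s s' : size s <= N ->
  den N [:: enc_seq s; enc_seq s'] lAppend = enc_seq (s ++ s').
Proof. by move=> sz; rewrite (den_fold _ _ (s := s)) //; elim: s {sz} => //= x s ->. Qed.

Definition lAddn := LFold (LVar 0) (LVar 1) (LCons LNil (LVar 1)).

Lemma add_idx i : den N [:: enc_idx n; enc_nat i] lAddn = enc_nat (n + i).
Proof.
rewrite (den_fold_tab _ _ (f := fun i : 'I_n => enc_nat i)) //.
transitivity (enc_nat (size (enum 'I_n) + i)); last by rewrite size_enum_ord.
by elim: (enum 'I_n) => //= j s ->.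
Qed.

Definition lInLeft i idxn := LApp lLt [:: i; idxn].
Definition lUnshift idxn i := LApp lDrop [:: idxn; i].

Definition lSplit := lTab (LVar 2) (lTab (LVar 4)
  (LIf (lInLeft (LVar 2) (LVar 5))
    (LIf (lInLeft (LVar 0) (LVar 5)) LNil (lEqn (LVar 2) (lUnshift (LVar 5) (LVar 0))))
    (LIf (lInLeft (LVar 0) (LVar 5)) (lRel (LVar 4) (lUnshift (LVar 5) (LVar 2)) (LVar 0)) LNil))).

Lemma den_left env i idxn e1 e2 (j : 'I_(n + n)) : den N env i = enc_nat j ->
  den N env idxn = enc_idx n ->
  den N env (LIf (lInLeft i idxn) e1 e2) = if j < n then den N env e1 else den N env e2.
Proof. by move=> Ei En; apply: den_if; rewrite den_app2 Ei En lt_idx. Qed.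

Lemma den_unshift env i idxn (u : 'I_n) : den N env i = enc_nat (n + u) ->
  den N env idxn = enc_idx n -> den N env (lUnshift idxn i) = enc_nat u.
Proof. by move=> Ei En; rewrite den_app2 Ei En sub_idx addKn. Qed.

Lemma lshift_lt (u : 'I_n) : lshift n u < n. Proof. exact: (ltn_ord u). Qed.
Lemma rshift_lt (u : 'I_n) : rshift n u < n = false.
Proof. by apply/negbTE; rewrite -leqNgt leq_addr. Qed.

Lemma lSplitE G : den N [:: enc_graph G; enc_idx n; enc_idx (n + n)] lSplit = enc_rel (split_graph G).
Proof.
apply: den_tab => // i acc; apply: den_tab => // j acc'.
rewrite (den_left _ _ (j := i)) // !(den_left _ _ (j := j)) //.
case: (split_ordP i) => u ->; case: (split_ordP j) => v ->;
  rewrite ?split_ll ?split_rr ?split_lr ?split_rl ?lshift_lt ?rshift_lt //.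
  by apply: (den_eqn (m := n)) => //; apply: den_unshift.
by apply: (den_rel (m := n)) => //; apply: den_unshift.
Qed.

Definition lSources := lTab (LVar 2)
  (LIf (lInLeft (LVar 0) (LVar 3)) LNil (lGet (LVar 2) (lUnshift (LVar 3) (LVar 0)))).

Lemma lSourcesE X : den N [:: enc_set X; enc_idx n; enc_idx (n + n)] lSources = enc_set (sources X).
Proof.
apply: den_set => // i acc; rewrite (den_left _ _ (j := i)) //.
case: (split_ordP i) => u ->; rewrite ?sources_l ?sources_r ?sinks_l ?sinks_r ?lshift_lt ?rshift_lt //.
by apply: den_mem => //; apply: den_unshift.
Qed.

Definition lSinks := lTab (LVar 2)
  (LIf (lInLeft (LVar 0) (LVar 3)) (lGet (LVar 2) (LVar 0)) LNil).

Lemma lSinksE X : den N [:: enc_set X; enc_idx n; enc_idx (n + n)] lSinks = enc_set (sinks X).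
Proof.
apply: den_set => // i acc; rewrite (den_left _ _ (j := i)) //.
case: (split_ordP i) => u ->; rewrite ?sources_l ?sources_r ?sinks_l ?sinks_r ?lshift_lt ?rshift_lt //.
exact: den_mem.
Qed.

Definition lCut :=
  LLet (LApp lSources [:: LVar 1; LVar 3; LVar 4])
  (LLet (LApp lSinks [:: LVar 3; LVar 4; LVar 5])
  (LLet (LFold (LVar 5) (LApp lSplit [:: LVar 2; LVar 5; LVar 6])
          (LApp lAugment [:: LVar 1; LVar 3; LVar 2; LVar 8]))
  (LLet (LApp lSearch [:: LVar 0; LVar 2; LVar 7])
  (lTab (LVar 7) (LIf (lGet (LVar 2) (LApp lAddn [:: LVar 9; LVar 0])) lTrue LNil))))).

Lemma lCutE G X Y :
  den N [:: enc_graph G; enc_set X; enc_set Y; enc_idx n; enc_idx (n + n)] lCut = enc_set (cut G X Y).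
Proof.
apply: den_let; first exact: lSourcesE.
apply: den_let; first exact: lSinksE.
apply: (den_let (v := enc_rel (cut_residual G X Y))).
  have [s sz Es] := enc_idx_seq.
  apply: (den_iter (enc := @enc_rel (n + n)) (s := s)) => //.
    exact: lSplitE.
  by move=> x D; apply: lAugmentE.
apply: den_let; first exact: lSearchE.
apply: den_set => // v acc; rewrite inE; apply: den_known.
apply: (den_get (f := fun i => enc_path (search (cut_residual G X Y) (sources X) i))) => //.
exact: add_idx.
Qed.

Definition lCmp :=
  LLet (lTab (LVar 3) (lTab (LVar 5) (lAnd (lNot (lGet (LVar 5) (LVar 2)))
    (lAnd (lNot (lGet (LVar 5) (LVar 0))) (lRel (LVar 4) (LVar 2) (LVar 0))))))
  (LApp lKnown [:: LApp lSearch [:: LVar 0; LVar 3; LVar 4]; LVar 4]).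

Lemma known_search_cmp G C b : known (search (adj_del G C) [set b]) = cmp G C b.
Proof.
apply/eqP; rewrite eqEsubset; apply/andP; split.
  apply: search_min; first by rewrite sub1set mem_cmp.
  move=> i j; rewrite !inE => bi ij; apply: connect_trans bi _; exact: connect1.
apply/subsetP=> v; rewrite inE => bv.
apply: (connect_ind (P := mem (known (search (adj_del G C) [set b]))) _ _ bv) => /=.
  by move=> i j; apply: search_closed.
by apply: (subsetP (search_source _ _)); rewrite inE.
Qed.

Lemma lCmpE G C b :
  den N [:: enc_graph G; enc_set C; enc_set [set b]; enc_idx n] lCmp = enc_set (cmp G C b).
Proof.
apply: (den_let (v := enc_rel (adj_del G C))).
  apply: den_tab => // i acc; apply: den_tab => // j acc'.
  apply: den_and; first by apply: den_not; apply: den_mem.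
  apply: den_and; first by apply: den_not; apply: den_mem.
  exact: (den_rel (D := adj G)).
rewrite -known_search_cmp den_app2.
rewrite -[X in den N [:: X; _]]/(den N [:: enc_rel (adj_del G C); enc_set [set b]; enc_idx n] lSearch).
by rewrite lSearchE // lKnownE.
Qed.

Definition lLess := LIf (LFold (LVar 0) (LVar 1)
  (LIf (LVar 0) (LCase (LVar 1) LNil (LVar 1)) (LVar 1))) lTrue LNil.

Lemma lLessE C K : den N [:: enc_set C; enc_nat K] lLess = enc_bool (#|C| < K).
Proof.
have E : den N [:: enc_set C; enc_nat K] (LFold (LVar 0) (LVar 1)
    (LIf (LVar 0) (LCase (LVar 1) LNil (LVar 1)) (LVar 1))) = enc_nat (K - #|C|).
  rewrite (den_fold_tab _ _ (f := fun i => enc_bool (i \in C))) // cardE /enum_mem size_filter.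
  rewrite -enumT; elim: (enum 'I_n) => [|i s IH]; first by rewrite subn0.
  rewrite [LHS]foldr_cons IH /=; case: (i \in C) => /=; last by rewrite add0n.
  by rewrite add1n subnS; case: (K - _).
by rewrite -subn_gt0 /lLess; move: E; move: (LFold _ _ _) => e /= ->; case: (K - _).
Qed.

Definition lAddEach := LFold (LVar 3) (LVar 2) (LIf (lGet (LVar 2) (LVar 0))
  (LCons (lTab (LVar 5) (lOr (lEqn (LVar 0) (LVar 2)) (lGet (LVar 5) (LVar 0)))) (LVar 1)) (LVar 1)).

Lemma lAddEachE A B Xs : den N [:: enc_set A; enc_set B; enc_sets Xs; enc_idx n] lAddEach =
  enc_sets (add_each A B ++ Xs).
Proof.
rewrite (den_fold_tab _ _ (f := fun i : 'I_n => enc_nat i)) // /add_each.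
elim: (enum 'I_n) => // v s IH; rewrite [LHS]foldr_cons IH; cbv beta.
rewrite (den_if _ _ (x := v \in A)); last exact: den_mem.
rewrite [in RHS]/=; case: (v \in A) => //.
rewrite den_pair.
apply: (congr1 (fun t => Cons t (enc_sets ([seq v |: B | v <- s & v \in A] ++ Xs)))).
apply: den_set => // w acc.
by rewrite in_setU1; apply: den_or; [apply: den_eqn | apply: den_mem].
Qed.

Definition lState e0 e1 e2 e3 e4 e5 e6 e7 :=
  LCons e0 (LCons e1 (LCons e2 (LCons e3 (LCons e4 (LCons e5 (LCons e6 e7)))))).

(* Environment of lSkip, lOk and lVisit: the cut N(A), A, the indices below 2n and below n,
   the graph, {b}, the budget, X, Y, then the other fields of the state. *)
Definition lSkip := LCons (lState (LVar 4) (LVar 5) (LVar 6) (LVar 7) (LVar 9) (LVar 10)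
  (LVar 11) (LVar 12)) LNil.

Definition lOk := lAnd
  (lAnd (LApp lDisj [:: LVar 1; LVar 8; LVar 3])
    (lAnd (LApp lDisj [:: LVar 0; LVar 8; LVar 3]) (LApp lLess [:: LVar 0; LVar 6])))
  (lNot (LApp lTmem [:: LVar 10; LVar 0])).

Definition lVisit :=
  LLet (LApp lAddEach [:: LVar 0; LApp lCmp [:: LVar 4; LVar 0; LVar 5; LVar 3]; LVar 9; LVar 3])
  (LLet (LApp lTins [:: LVar 11; LVar 1])
  (LIf (LApp lTmem [:: LVar 14; LVar 2])
    (LCons (lState (LVar 6) (LVar 7) (LVar 8) (LVar 9) (LVar 1) (LVar 0) (LVar 13) (LVar 14)) LNil)
    (LCons (lState (LVar 6) (LVar 7) (LVar 8) (LVar 9) (LVar 1) (LVar 0)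
        (LApp lAddEach [:: LVar 2; LVar 3; LVar 13; LVar 5]) (LApp lTins [:: LVar 14; LVar 2]))
      (LCons (LVar 2) LNil)))).

Definition lProcess :=
  LLet (LApp lIdx [:: LVar 0])
  (LLet (LApp lIdx [:: LApp lAppend [:: LVar 1; LVar 1]])
  (LLet (LApp lCut [:: LVar 2; LVar 5; LVar 6; LVar 1; LVar 0])
  (LLet (LApp lNbr [:: LVar 3; LVar 0; LVar 2])
  (LIf lOk lVisit lSkip)))).

Definition lStepBody := LCase (LVar 4)
  (LCase (LVar 6) LNil
    (LCons (lState (LVar 2) (LVar 3) (LVar 4) (LVar 0) (LCons (LVar 3) LNil) LNil (LVar 1)
      (LVar 9)) LNil))
  (LApp lProcess [:: LVar 2; LVar 3; LVar 4; LVar 5; LVar 0; LVar 1; LVar 7; LVar 8; LVar 9]).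

Definition lHead e := LCase e LNil (LVar 0).
Definition lTail e := LCase e LNil (LVar 1).

Definition lStepMain :=
  let t i := iter i lTail (LVar 0) in
  LApp lStepBody [:: lHead (t 0); lHead (t 1); lHead (t 2); lHead (t 3); lHead (t 4);
    lHead (t 5); lHead (t 6); t 7].

Lemma enc_graph_seq G : exists2 s, size s = n & enc_graph G = enc_seq s.
Proof.
by exists [seq enc_seq [seq enc_bool (adj G i j) | j <- enum 'I_n] | i <- enum 'I_n];
  rewrite // size_map size_enum_ord.
Qed.

Lemma lStepMainE G b K st :
  den N [:: enc_state G b K st] lStepMain = enc_step G b K (step G b K st).
Proof.
case: st => X pend vis tsk fnd.
rewrite -[LHS]/(den N [:: enc_graph G; enc_set [set b]; enc_nat K; enc_set X; enc_sets pend;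
  vis; enc_sets tsk; fnd] lStepBody).
case: pend => [|Y pend]; first by case: tsk.
rewrite -[LHS]/(den N [:: enc_graph G; enc_set [set b]; enc_nat K; enc_set X; enc_set Y;
  enc_sets pend; vis; enc_sets tsk; fnd] lProcess).
have [s sz Es] := enc_graph_seq G.
rewrite /step; set A := cut G X Y; set C := nbr G A.
apply: (den_let (v := enc_idx n)).
  by rewrite den_app1 -(lIdxE sz nN1) -Es.
apply: (den_let (v := enc_idx (n + n))).
  rewrite den_app1 den_app2 -(lIdxE (s := s ++ s) _ nN) ?size_cat ?sz // -lAppendE ?sz //.
  by rewrite -Es.
apply: (den_let (v := enc_set A)); first exact: lCutE.
apply: (den_let (v := enc_set C)); first exact: lNbrE.
rewrite (den_if _ _ (x := [&& [disjoint A & Y], [disjoint C & Y] & #|C| < K] && ~~ tmem vis (set_key C))).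
  case: ifP => // _.
  apply: (den_let (v := enc_sets (add_each C (cmp G C b) ++ pend))).
    rewrite -(lAddEachE C (cmp G C b)) -lCmpE; reflexivity.
  apply: (den_let (v := tins vis (set_key C))).
    by rewrite -(@lTinsE N) ?size_set_key // -enc_set_key.
  rewrite (den_if _ _ (x := tmem fnd (set_key C))); last first.
    by rewrite -(@lTmemE N) ?size_set_key // -enc_set_key.
  case: ifP => // _.
  rewrite /enc_step /enc_state -(lAddEachE C A tsk) -!(@lTinsE N) ?size_set_key // -enc_set_key.
  reflexivity.
apply: den_and; last by apply: den_not; rewrite -(@lTmemE N) ?size_set_key // -enc_set_key.
apply: den_and; first exact: lDisjE.
by apply: den_and; [exact: lDisjE | exact: lLessE].
Qed.

End StepCode.

(* Sizes are compared strictly with the budget, so that 0 stands for a negative k. *)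
Definition budget (k : int) := if k is Posz m then m.+1 else 0.

(** Besides the state this returns the counter for the steps: the rows of the adjacency matrix taken
    twice, a list of length 2n. *)
Definition lInit := LLet (LApp lIdx [:: LVar 0])
  (LCons (LApp lAppend [:: LVar 1; LVar 1])
    (lState (LVar 1) (lTab (LVar 0) (lEqn (LVar 0) (LVar 5)))
      (LCase (LVar 4) LNil (LIf (LVar 0) LNil (LCons LNil (LVar 1))))
      (lTab (LVar 0) (lEqn (LVar 0) (LVar 4)))
      (LCons (lTab (LVar 0) (lEqn (LVar 0) (LVar 5))) LNil) LNil LNil LNil)).

Definition init_state n (a b : 'I_n) := State [set a] [:: [set b]] Nil [::] Nil.

Lemma lInitE n (G : sgraph 'I_n) (a b : 'I_n) k : exists2 s, size s = n + n &
  den n (enc_input G a b k) lInit =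
  Cons (enc_seq s) (enc_state G b (budget k) (init_state a b)).
Proof.
have [s sz Es] := enc_graph_seq G; exists (s ++ s); first by rewrite size_cat sz.
apply: (den_let (v := enc_idx n)); first by rewrite den_app1 -(lIdxE sz (leqnn n)) -Es.
have H x (v : 'I_n) env e1 : den n env (LVar 0) = enc_idx n ->
    (forall y z, den n [:: y, z & env] e1 = enc_nat v) -> x = [set v] ->
    den n env (lTab (LVar 0) (lEqn (LVar 0) e1)) = enc_set x.
  move=> E0 E1 ->; apply: den_set => // i acc; rewrite in_set1.
  by apply: (den_eqn (m := n)) => //; apply: E1.
rewrite den_pair; congr Cons.
  by rewrite den_app2 -(lAppendE (N := n)) ?sz // -Es.
rewrite /lState /init_state /enc_state !den_pair; congr Cons; congr Cons; first exact: (H _ b).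
congr Cons; first by case: k.
congr Cons; first exact: (H _ a).
congr Cons; apply: (congr1 (fun t => Cons t Nil)); exact: (H _ b).
Qed.

(** * Invariant of the enumeration *)

Section Invariant.
Variables (n : nat) (G : sgraph 'I_n) (a b : 'I_n) (K : nat).
Implicit Types (X Y A B C : {set 'I_n}) (st : state n) (O V : seq {set 'I_n}).
Local Notation nbr := (nbr G).
Local Notation cmp := (cmp G).
Local Notation conn := (conn G).
Local Notation solution := (solution G a b K).
Local Notation closest := (closest G a b K).

(** Bounds the cuts visited in one task. K is one more than the allowed size, hence the exponent
    K.-1. *)
Definition width r := minn (4 ^ K.-1) r.

(* O lists the output so far and V the sets A visited in the current task,
   d tasks have been completed, and s steps have been performed. *)
Record search_invariant st O V d s : Prop := SearchInvariant {
  inv_uniqO : uniq O;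
  inv_solO : forall C, C \in O -> solution C;
  inv_found : forall C, tmem (found st) (set_key C) = (C \in O);
  inv_uniqV : uniq V;
  inv_cutV : forall A, A \in V -> #|nbr A| < K /\ exists2 Y, conn b Y & is_cut G (source st) Y A;
  inv_VO : forall A, A \in V -> nbr A \in O;
  inv_visited : forall C, tmem (visited st) (set_key C) = (C \in [seq nbr A | A <- V]);
  inv_connX : conn a (source st);
  inv_connY : forall Y, Y \in pending st -> conn b Y;
  inv_next : forall Y,
    Y = [set b] \/ (exists A v, [/\ A \in V, v \in nbr A & Y = v |: cmp (nbr A) b]) ->
    Y \in pending st \/ (cut_ok G K (cut G) (source st) Y -> cut G (source st) Y \in V);
  inv_connT : forall X, X \in tasks st -> conn a X;
  inv_task : forall X,
    X = [set a] \/ (exists C x, [/\ C \in O, x \in C & X = x |: cmp C a]) ->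
    [\/ X \in tasks st, X = source st | forall C, closest X C -> C \in O];
  inv_steps : s + size (pending st) <= d * (2 + n * width (size O)) + 1 + n * size V;
  inv_done : d + size (tasks st) <= n * size O
}.

Lemma visited_cmp st O V d s A : search_invariant st O V d s -> A \in V -> cmp (nbr A) a = A.
Proof. by move=> I /(inv_cutV I)[_ [Y _ cutA]]; apply: cut_cmp (inv_connX I) cutA. Qed.

Lemma size_visited st O V d s : search_invariant st O V d s -> size V <= width (size O).
Proof.
move=> I; rewrite /width leq_min; apply/andP; split.
  rewrite -(card_uniqP (inv_uniqV I)) -cardsE.
  apply: (card_cuts (inv_connX I) (b := b)) => A; rewrite inE => /(inv_cutV I)[lt cutA].
  by split=> //; move: lt; case: (K).
have uV : uniq [seq nbr A | A <- V].
  rewrite map_inj_in_uniq ?(inv_uniqV I) // => A A' AV A'V E.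
  by rewrite -(visited_cmp I AV) -(visited_cmp I A'V) E.
rewrite -(size_map nbr V); apply: uniq_leq_size uV _ => _ /mapP[A AV ->].
exact: (inv_VO I).
Qed.

(** The quantity s + size (pending st) is unchanged when a set Y is skipped, rises by at most n at a
    visit, and by 2 when a task starts, at which point the n * size V of the finished task is
    charged to d. The bound inserts d <= n * r and size V <= width r. *)
Definition bound r := n * r * (2 + n * width r) + 1 + n * width r.

Lemma inv_bound st O V d s : search_invariant st O V d s -> s <= bound (size O).
Proof.
move=> I; have le1 := size_visited I; have le2 := inv_steps I; have le3 := inv_done I.
apply: leq_trans (leq_trans (leq_addr _ _) le2) _; rewrite /bound.
apply: leq_add; last by rewrite leq_mul2l le1 orbT.
by rewrite leq_add2r leq_mul2r (leq_trans (leq_addr _ _) le3) orbT.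
Qed.

Lemma inv_init : search_invariant (init_state a b) [::] [::] 0 0.
Proof.
split=> //=; try by [move=> C; rewrite tmem_nil | exact: conn1].
- by move=> Y; rewrite inE => /eqP->; apply: conn1.
- move=> Y [->|[A [v [//]]]]; left; exact: mem_head.
- by move=> X [->|[C [x [//]]]]; constructor 2.
Qed.

Lemma size_add_each A B : size (add_each A B) <= n.
Proof. by rewrite size_map size_filter (leq_trans (count_size _ _)) // size_enum_ord. Qed.

Lemma mem_add_each A B X : reflect (exists2 v, v \in A & X = v |: B) (X \in add_each A B).
Proof.
apply: (iffP mapP) => [[v]|[v vA ->]]; first by rewrite mem_filter => /andP[vA _]; exists v.
by exists v; rewrite // mem_filter vA mem_enum.
Qed.

(** With nothing pending, [inv_next] says exactly that V is closed under the rules required by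
    [closest_visited]. *)
Lemma task_done st O V d s : search_invariant st O V d s -> pending st = [::] ->
  forall C, closest (source st) C -> C \in O.
Proof.
move=> I E C closeC.
have [/andP[minC _] _ _] := closeC; have [_ _ _ NA _] := min_sep_nbr minC.
rewrite -NA; apply: (inv_VO I).
apply: (closest_visited (cut := cut G) (V := mem V) _ (inv_connX I) _ closeC).
  exact: cutP.
move=> Y conY ok /= H; case: (inv_next I H) => [|inV]; first by rewrite E.
exact: inV.
Qed.

Lemma inv_stop st O V d s : search_invariant st O V d s -> pending st = [::] -> tasks st = [::] ->
  forall C, solution C -> C \in O.
Proof.
move=> I E1 E2.
have H X : X = [set a] \/ (exists C x, [/\ C \in O, x \in C & X = x |: cmp C a]) ->
    forall C, closest X C -> C \in O.
  by case/(inv_task I) => [|->|//]; [rewrite E2 | exact: task_done I E1].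
apply: (solutions_complete (O := mem O)) => /=.
- exact: inv_solO I.
- by apply: H; left.
- by move=> C C' x CO xC; apply: H; right; exists C, x.
Qed.

Lemma inv_next_task st O V d s X tsk : search_invariant st O V d s -> pending st = [::] ->
  tasks st = X :: tsk ->
  search_invariant (State X [:: [set b]] Nil tsk (found st)) O [::] d.+1 s.+1.
Proof.
move=> I E1 E2; have dn := task_done I E1; have le := size_visited I.
split=> //=; rewrite ?(inv_uniqO I) //; try exact: (inv_solO I).
- exact: inv_found I.
- by move=> C; rewrite tmem_nil.
- by apply: (inv_connT I); rewrite E2 mem_head.
- by move=> Y; rewrite inE => /eqP->; apply: conn1.
- move=> Y [->|[A [v [//]]]]; left; exact: mem_head.
- by move=> X' X'T; apply: (inv_connT I); rewrite E2 inE X'T orbT.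
- move=> X' /(inv_task I)[|->|]; [|by constructor 3|by constructor 3].
  by rewrite E2 inE => /orP[/eqP->|?]; [constructor 2 | constructor 1].
- have := inv_steps I; rewrite E1 /= addn0 mulSn muln0.
  have : n * size V <= n * width (size O) by rewrite leq_mul2l le orbT.
  by lia.
- by have := inv_done I; rewrite E2 /=; lia.
Qed.

Lemma cut_okE X Y : cut_ok G K (cut G) X Y =
  [&& [disjoint cut G X Y & Y], [disjoint nbr (cut G X Y) & Y] & #|nbr (cut G X Y)| < K].
Proof. by rewrite /cut_ok /feasible cut_sub /= -andbA. Qed.

(** The trie stores boundaries, not sides; this loses nothing, because a visited A is the component
    of a off N(A). *)
Lemma inv_skip st O V d s Y pend : search_invariant st O V d s -> pending st = Y :: pend ->
  (cut_ok G K (cut G) (source st) Y -> tmem (visited st) (set_key (nbr (cut G (source st) Y)))) ->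
  search_invariant (State (source st) pend (visited st) (tasks st) (found st)) O V d s.+1.
Proof.
move=> I E H; case: (I) => *; split=> //=.
- by move=> Y' Y'p; apply: (inv_connY I); rewrite E inE Y'p orbT.
- move=> Y' /(inv_next I)[|?]; last by right.
  rewrite E inE => /orP[/eqP->|?]; [right=> ok | by left].
  have := H ok; rewrite (inv_visited I) => /mapP[A AV EA].
  suff -> : cut G (source st) Y = A by [].
  rewrite -(visited_cmp I AV) -EA; apply/esym.
  by case/andP: ok => f _; exact: cut_cmp (inv_connX I) (cutP f).
- by have := inv_steps I; rewrite E /= [s.+1 + _]addSnnS.
Qed.

Section Visit.
Variables (st : state n) (O V : seq {set 'I_n}) (d s : nat).
Variables (Y : {set 'I_n}) (pend : seq {set 'I_n}).
Hypotheses (I : search_invariant st O V d s) (E : pending st = Y :: pend).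
Let A := cut G (source st) Y.
Let C := nbr A.
Hypotheses (ok : cut_ok G K (cut G) (source st) Y) (new : ~~ tmem (visited st) (set_key C)).

Let conY : conn b Y.
Proof. by apply: (inv_connY I); rewrite E mem_head. Qed.
Let cutA : is_cut G (source st) Y A.
Proof. by case/andP: ok => f _; apply: cutP f. Qed.

Lemma visit_solution : solution C.
Proof.
apply/andP; split; first exact: cut_min_sep (inv_connX I) conY cutA.
by case/andP: ok.
Qed.

(** The output, the trie of found cuts and the tasks are left abstract, so that a rediscovered cut
    and a new one share the argument about the search. *)
Lemma inv_visit O' fnd tsk :
  uniq O' -> (forall C', C' \in O' -> solution C') ->
  (forall C', tmem fnd (set_key C') = (C' \in O')) -> C \in O' -> {subset O <= O'} ->
  size O <= size O' ->
  (forall X, X \in tsk -> conn a X) ->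
  (forall X, X = [set a] \/ (exists C x, [/\ C \in O', x \in C & X = x |: cmp C a]) ->
    [\/ X \in tsk, X = source st | forall C, closest X C -> C \in O']) ->
  d + size tsk <= n * size O' ->
  search_invariant (State (source st) (add_each C (cmp C b) ++ pend) (tins (visited st) (set_key C))
    tsk fnd) O' (A :: V) d s.+1.
Proof.
move=> uO' sO' fO' CO' sub leO conT tsk' dn.
have NB : nbr (cmp C b) = C := cut_nbr_b conY cutA.
split=> //=.
- rewrite (inv_uniqV I) andbT; apply: contra new => AV.
  by rewrite (inv_visited I) map_f.
- move=> A'; rewrite inE => /orP[/eqP->|]; last by move=> A'V; apply: (inv_cutV I).
  by split; [case/andP: ok | exists Y].
- move=> A'; rewrite inE => /orP[/eqP->//|A'V]; apply: sub; exact: (inv_VO I).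
- by move=> C'; rewrite tmem_ins ?size_set_key // (inv_visited I) (inj_eq (@set_key_inj n)).
- exact: inv_connX I.
- move=> Y'; rewrite mem_cat => /orP[/mem_add_each[v vC ->]|Y'p].
    by apply: conn_add (conn_cmp _ _ _) _; rewrite NB.
  by apply: (inv_connY I); rewrite E inE Y'p orbT.
- move=> Y' H.
  have [old|[v vC EY]] : (Y' = [set b] \/ exists A v, [/\ A \in V, v \in nbr A & Y' = v |: cmp (nbr A) b])
      \/ exists2 v, v \in C & Y' = v |: cmp C b.
    case: H => [|[A' [v [+ vA' EY]]]]; first by left; left.
    rewrite inE => /orP[/eqP EA|A'V]; last by left; right; exists A', v.
    by right; exists v; rewrite ?EY /C -?EA.
  + case: (inv_next I old) => [|inV]; last by right=> /inV; rewrite inE orbC => ->.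
    rewrite E inE => /orP[/eqP->|Y'p]; first by right=> _; apply: mem_head.
    by left; rewrite mem_cat Y'p orbT.
  + by left; rewrite mem_cat; apply/orP; left; apply/mem_add_each; exists v.
- have le1 := size_add_each C (cmp C b); have le2 := inv_steps I; rewrite E /= in le2.
  have le3 : width (size O) <= width (size O').
    by rewrite /width leq_min geq_minl (leq_trans (geq_minr _ _)).
  have le4 : d * (2 + n * width (size O)) <= d * (2 + n * width (size O')).
    by rewrite leq_mul2l leq_add2l leq_mul2l le3 !orbT.
  by rewrite size_cat mulnS; lia.
Qed.

Lemma inv_visit_old : tmem (found st) (set_key C) ->
  search_invariant (State (source st) (add_each C (cmp C b) ++ pend) (tins (visited st) (set_key C))
    (tasks st) (found st)) O (A :: V) d s.+1.
Proof.
by rewrite (inv_found I) => CO; case: (I) => *; apply: inv_visit.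
Qed.

Lemma inv_visit_new : ~~ tmem (found st) (set_key C) ->
  C \notin O /\
  search_invariant (State (source st) (add_each C (cmp C b) ++ pend) (tins (visited st) (set_key C))
    (add_each C A ++ tasks st) (tins (found st) (set_key C))) (rcons O C) (A :: V) d s.+1.
Proof.
rewrite (inv_found I) => CO; split=> //.
have EA : cmp C a = A := cut_cmp (inv_connX I) cutA.
apply: inv_visit.
- by rewrite rcons_uniq CO (inv_uniqO I).
- by move=> C'; rewrite mem_rcons inE => /orP[/eqP->|]; [exact: visit_solution | exact: (inv_solO I)].
- move=> C'; rewrite tmem_ins ?size_set_key // (inv_found I) (inj_eq (@set_key_inj n)).
  by rewrite mem_rcons.
- by rewrite mem_rcons mem_head.
- by move=> C' C'O; rewrite mem_rcons inE C'O orbT.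
- by rewrite size_rcons.
- move=> X; rewrite mem_cat => /orP[/mem_add_each[v vC ->]|]; last exact: (inv_connT I).
  by apply: conn_add => //; rewrite -EA; apply: conn_cmp.
- move=> X H.
  have [old|[v vC EX]] : (X = [set a] \/ exists C x, [/\ C \in O, x \in C & X = x |: cmp C a])
      \/ exists2 v, v \in C & X = v |: A.
    case: H => [|[C' [v [+ vC' EX]]]]; first by left; left.
    rewrite mem_rcons inE => /orP[/eqP EC|C'O]; last by left; right; exists C', v.
    by right; exists v; rewrite -?EA -?EC.
  + case: (inv_task I old) => [inT|->|dn].
    * by constructor 1; rewrite mem_cat inT orbT.
    * by constructor 2.
    * by constructor 3 => C' /dn C'O; rewrite mem_rcons inE C'O orbT.
  + by constructor 1; rewrite mem_cat; apply/orP; left; apply/mem_add_each; exists v.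
- rewrite size_cat size_rcons mulnS addnCA.
  exact: leq_add (size_add_each C A) (inv_done I).
Qed.

End Visit.

Lemma inv_step st O V d s : search_invariant st O V d s ->
  match step G b K st with
  | None => forall C, solution C -> C \in O
  | Some (st', None) => exists V' d', search_invariant st' O V' d' s.+1
  | Some (st', Some C) => C \notin O /\ exists V' d', search_invariant st' (rcons O C) V' d' s.+1
  end.
Proof.
case: st => X [|Y pend] vis tsk fnd I /=.
  case: tsk I => [|X' tsk] I; first exact: (inv_stop I).
  by exists [::], d.+1; apply: (inv_next_task I).
case: ifPn => [/andP[ok new]|skip].
  rewrite -cut_okE in ok; case: ifPn => fC.
    by exists (cut G X Y :: V), d; apply: (inv_visit_old I).
  have [CO I'] := inv_visit_new I erefl ok new fC.
  by split=> //; exists (cut G X Y :: V), d.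
exists V, d; apply: (inv_skip I (Y := Y)) => // ok; apply: contraNT skip => new.
by rewrite -cut_okE ok.
Qed.

End Invariant.

(** * The program *)

(** For steps, whose counter has length 2n. *)
Lemma poly_bounded_double K : poly_bounded K -> poly_bounded (fun N => K (N + N)).
Proof.
move=> [c [d H]]; exists (c * 2 ^ d), d => N; apply: leq_trans (H _) _.
rewrite -mulnA -expnMn leq_mul2l; apply/orP; right.
by case: d {H} => // d; rewrite leq_exp2r //; lia.
Qed.

(** Functions 0 to 3 are main, loop, initialisation and step; generated functions follow from 4. The
    graph itself, a list of n rows, is the counter of the initialisation. *)
Definition main_expr := ECase (ECall 2 [:: EVar 0; EVar 1; EVar 2; EVar 3; EVar 0]) ENil
  (ECall 1 [:: EVar 1; EVar 0]).

Definition loop_expr := ECase (ECall 3 [:: EVar 0; EVar 1]) ENil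
  (ECase (EVar 1) (ECall 1 [:: EVar 0; EVar 3])
    (ELet (EOut (EVar 0)) (ECall 1 [:: EVar 3; EVar 6]))).

Lemma width_mono K r r' : r <= r' -> width K r <= width K r'.
Proof. by move=> le; rewrite /width leq_min geq_minl (leq_trans (geq_minr _ _)). Qed.

Lemma bound_mono n K r r' : r <= r' -> bound n K r <= bound n K r'.
Proof.
move=> le; have lew := width_mono K le; rewrite /bound.
apply: leq_add; last by rewrite leq_mul2l lew orbT.
rewrite leq_add2r; apply: leq_mul; first by rewrite leq_mul2l le orbT.
by rewrite leq_add2l leq_mul2l lew orbT.
Qed.

Section Run.
Variables (n : nat) (G : sgraph 'I_n) (a b : 'I_n) (K : nat) (p : program) (cnt : tree) (c : nat).
Hypothesis loopE : nth ENil p 1 = loop_expr.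
Hypothesis stepE : forall st, pev p [:: enc_state G b K st; cnt] (nth ENil p 3)
  (enc_step G b K (step G b K st)) c.
Local Notation search_invariant := (search_invariant G a b K).
Local Notation bound := (bound n K).

Let c' := c + 20.

Lemma step_call st : pev p [:: enc_state G b K st; cnt] (ECall 3 [:: EVar 0; EVar 1])
  (enc_step G b K (step G b K st)) (1 + (1 + (1 + 0)) + c).
Proof.
apply: pev_call (stepE st); do 2 (apply: pevs_cons; first exact: pev_var).
exact: pevs_nil.
Qed.

(** Fuel cannot run out, since s is at most the bound for the number of all vertex sets; this yields
    termination. The step that emits an output is performed when s is bounded in terms of the
    outputs already made, and c' covers one step and the overhead of the loop. *)
Lemma loop_run fuel st O V d s t0 t : search_invariant st O V d s ->
  bound #|{: {set 'I_n}}| < s + fuel -> t <= t0 + c' * s ->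
  exists v t' o Os,
    [/\ eval p [:: enc_state G b K st; cnt] loop_expr t v t' o,
        [seq w.2 | w <- o] = [seq enc_set X | X <- Os],
        uniq (O ++ Os) /\ (forall X, (X \in O ++ Os) = solution G a b K X),
        forall i, i < size o -> (nth (0, Nil) o i).1 <= t0 + c' * (bound (size O + i)).+1 &
        t' <= t0 + c' * (bound (size (O ++ Os))).+1].
Proof.
elim: fuel st O V d s t => [|fuel IH] st O V d s t I lt le.
  have := inv_bound I; rewrite leqNgt; case/negP; rewrite addn0 in lt.
  apply: leq_ltn_trans lt; apply: bound_mono.
  by rewrite -(card_uniqP (inv_uniqO I)) max_card.
have leb := inv_bound I.
have le_s : c' * s.+1 <= c' * (bound (size O)).+1 by rewrite leq_mul2l ltnS leb orbT.
have leS : t + c' <= t0 + c' * s.+1 by rewrite mulnS addnCA addnC leq_add2l.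
have := inv_step I; have [q lq H] := step_call st; have {H} := H t.+1.
case: (step G b K st) => [[st' [C|]]|] /= H.
- case=> CO [V' [d' I']].
  have [q2 lq2 H2] : pevs p [:: Nil; enc_set C; Nil; enc_state G b K st'; Cons (enc_set C) Nil;
      enc_state G b K st; cnt] [:: EVar 3; EVar 6] [:: enc_state G b K st'; cnt] (1 + (1 + 0)).
    by do 2 (apply: pevs_cons; first exact: pev_var); exact: pevs_nil.
  pose t1 := t.+1 + q; pose t2 := t1.+2; pose t3 := t2.+3.
  have lt4 : t3.+1 + q2 <= t0 + c' * s.+1.
    by apply: leq_trans leS; rewrite /c' /t3 /t2 /t1; lia.
  have [v [t' [o [Os [ev Eo [uO sO] tm te]]]]] := IH _ _ _ _ _ _ I' ltac:(by rewrite addSnnS) lt4.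
  rewrite -loopE in ev.
  exists v, t', ((t3, enc_set C) :: o), (C :: Os); split.
  + have eo : eval p [:: enc_set C; Nil; enc_state G b K st'; Cons (enc_set C) Nil;
      enc_state G b K st; cnt] (EOut (EVar 0)) t2.+1 Nil t3 [:: (t3, enc_set C)].
      exact: eval_out (eval_var _ _ 0 _).
    have ec := eval_call (H2 _) ev.
    have el := eval_case_cons (ECall 1 [:: EVar 0; EVar 3]) 
      (eval_var p [:: enc_state G b K st'; Cons (enc_set C) Nil; enc_state G b K st; cnt] 1 _)
      (eval_let eo ec).
    have ev' := eval_case_cons ENil H el.
    exact: ev'.
  + by rewrite /= Eo.
  + by rewrite -cat_rcons.
  + case=> [|i] /= lti.
      rewrite addn0; apply: leq_trans (_ : t0 + c' * s.+1 <= _); last by rewrite leq_add2l.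
      by apply: leq_trans leS; rewrite /c' /t3 /t2 /t1; lia.
    by have := tm i lti; rewrite size_rcons addSnnS.
  + by move: te; rewrite -cat_rcons.
- case=> V' [d' I'].
  have [q2 lq2 H2] : pevs p [:: enc_state G b K st'; Nil; enc_state G b K st; cnt]
      [:: EVar 0; EVar 3] [:: enc_state G b K st'; cnt] (1 + (1 + 0)).
    by do 2 (apply: pevs_cons; first exact: pev_var); exact: pevs_nil.
  pose t1 := t.+1 + q; pose t2 := t1.+2.
  have lt4 : t2.+1 + q2 <= t0 + c' * s.+1.
    by apply: leq_trans leS; rewrite /c' /t2 /t1; lia.
  have [v [t' [o [Os [ev Eo uO tm te]]]]] := IH _ _ _ _ _ _ I' ltac:(by rewrite addSnnS) lt4.
  rewrite -loopE in ev.
  exists v, t', o, Os; split=> //.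
  have ec := eval_call (H2 _) ev.
  have el := eval_case_nil (ELet (EOut (EVar 0)) (ECall 1 [:: EVar 3; EVar 6]))
    (eval_var p [:: enc_state G b K st'; Nil; enc_state G b K st; cnt] 1 _) ec.
  have ev' := eval_case_cons ENil H el.
  exact: ev'.
- move=> done; exists Nil, (t.+1 + q).+1, [::], [::]; split=> //.
  + exact: eval_case_nil _ H (eval_nil _ _ _).
  + rewrite cats0 (inv_uniqO I); split=> // X; apply/idP/idP; last exact: done.
    exact: (inv_solO I).
  + rewrite cats0; apply: leq_trans (_ : t0 + c' * s.+1 <= _); last by rewrite leq_add2l.
    by apply: leq_trans leS; rewrite /c'; lia.
Qed.

End Run.

Lemma four_pow_budget k : four_pow k = 4 ^ (budget k).-1.
Proof. by case: k. Qed.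

(** In the factor, n * n + 2 * n pays for the tasks, another n for the cuts of the current one, and
    2 for the two units added. Since r < R, the product R * w is positive and absorbs these. *)
Lemma bound_width n K r R : r < R -> (bound n K r).+1 <= (n * n + 3 * n + 2) * (R * minn (4 ^ K.-1) R).
Proof.
move=> lt; set w := minn _ _.
have w0 : 0 < w by rewrite leq_min expn_gt0 (leq_trans _ lt).
have lew : width K r <= w by rewrite /width leq_min geq_minl (leq_trans (geq_minr _ _) (ltnW lt)).
have h1 : n * r * (2 + n * width K r) <= n * R * (w * (2 + n)).
  apply: leq_mul; first by rewrite leq_mul2l ltnW ?orbT.
  rewrite mulnDr leq_add //; first by rewrite leq_pmull.
  by rewrite mulnC leq_mul2r lew orbT.
have h2 : n * width K r <= n * (R * w).
  rewrite leq_mul2l; apply/orP; right; apply: leq_trans lew _.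
  by rewrite leq_pmull // (leq_trans _ lt).
have h3 : 0 < R * w by rewrite muln_gt0 w0 (leq_trans _ lt).
have -> : (n * n + 3 * n + 2) * (R * w) = n * R * (w * (2 + n)) + n * (R * w) + 2 * (R * w) by lia.
by rewrite /bound; lia.
Qed.

Theorem theorem1 :
  exists (p : program) (c d : nat),
  forall (n : nat) (G : sgraph 'I_n) (a b : 'I_n) (k : int),
  exists (o : seq (nat * tree)) (t : nat) (Ss : seq {set 'I_n}),
    [/\ runs p (enc_input G a b k) o t,
        [seq w.2 | w <- o] = [seq enc_set X | X <- Ss],
        uniq Ss,
        forall X : {set 'I_n},
          (X \in Ss) = min_separator G a b X && (Posz #|X| <= k)%R
      & forall R : nat,
          let B := (c * n ^ d) * (R * minn (four_pow k) R) in
          R <= size (output_by B o) \/ t <= B].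
Proof.
have [ci [qi [Ki [Pi Ci]]]] := compile lInit 4 4.
have [cs [qs [Ks [Ps Cs]]]] := compile lStepMain 1 (4 + size qi).
pose p : program := [:: main_expr; loop_expr; ci; cs] ++ qi ++ qs.
(* Initialisation, plus the cost of a step, run with the doubled counter, times the factor of
   [bound_width]. *)
pose Q N := Ki N + 20 + (Ks (N + N) + 20) * (N * N + 3 * N + 2).
have [c [d HQ]] : poly_bounded Q.
  have PN : poly_bounded id by exists 1, 1 => N; rewrite expn1 mul1n.
  have PC := poly_bounded_const.
  apply: poly_bounded_add; first exact: poly_bounded_add.
  apply: poly_bounded_mul; first by apply: poly_bounded_add (poly_bounded_double Ps) _.
  apply: poly_bounded_add => //; apply: poly_bounded_add; exact: poly_bounded_mul.
exists p, (c * 2 ^ d), d => n G a b k.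
have n0 : 0 < n by apply: leq_ltn_trans (ltn_ord a).
(* The vertex a makes n positive, so n.+1 ^ d <= 2 ^ d * n ^ d. *)
have Q_le : Q n <= c * 2 ^ d * n ^ d.
  apply: leq_trans (HQ n) _; rewrite -mulnA -expnMn leq_mul2l; apply/orP; right.
  by case: (d) => // d'; rewrite leq_exp2r //; lia.
have Ii : installed p 4 qi.
  by move=> i lt; rewrite /p nth_cat [size _]/= ltnNge leq_addr addKn nth_cat lt.
have Is : installed p (4 + size qi) qs.
  move=> i lt; rewrite /p nth_cat [size _]/= -addnA ltnNge leq_addr addKn nth_cat.
  by rewrite ltnNge leq_addr addKn.
pose K := budget k.
have [s sz Einit] := lInitE G a b k.
have [gs gsz Egs] := enc_graph_seq G.
have init : pev p (rcons (enc_input G a b k) (enc_graph G)) ci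
    (Cons (enc_seq s) (enc_state G b K (init_state a b))) (Ki n).
  have := Ci p (enc_input G a b k) (enc_graph G) Ii erefl.
  by rewrite Egs itemsK gsz Einit.
have stepE st : pev p [:: enc_state G b K st; enc_seq s] (nth ENil p 3)
    (enc_step G b K (step G b K st)) (Ks (n + n)).
  have := Cs p [:: enc_state G b K st] (enc_seq s) Is erefl.
  by rewrite itemsK sz lStepMainE.
pose T0 := Ki n + 20.
have [q1 lq1 H1] : pev p (enc_input G a b k)
    (ECall 2 [:: EVar 0; EVar 1; EVar 2; EVar 3; EVar 0])
    (Cons (enc_seq s) (enc_state G b K (init_state a b)))
    (1 + (1 + (1 + (1 + (1 + (1 + 0))))) + Ki n).
  apply: (pev_call _ (f := 2) init).
  by do 5 (apply: pevs_cons; first exact: pev_var); exact: pevs_nil.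
have [q2 lq2 H2] : pevs p [:: enc_seq s, enc_state G b K (init_state a b) & enc_input G a b k]
    [:: EVar 1; EVar 0] [:: enc_state G b K (init_state a b); enc_seq s] (1 + (1 + 0)).
  by do 2 (apply: pevs_cons; first exact: pev_var); exact: pevs_nil.
have le0 : (0.+1 + q1).+1 + q2 <= T0 + (Ks (n + n) + 20) * 0.
  by rewrite muln0 addn0 /T0; lia.
have [v [t [o [Os [ev Eo [uO sO] tm te]]]]] :=
  loop_run (p := p) erefl stepE (inv_init G a b K) (ltnSn _) le0.
have evm := eval_case_cons ENil (H1 1) (eval_call (p := p) (f := 1) (H2 _) ev).
exists o, t, Os; split=> //.
- by exists v; exact: evm.
- move=> X; rewrite sO /solution; congr (_ && _); rewrite /K /budget; case: (k) => // m.
- have Tle r R : r < R ->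
      T0 + (Ks (n + n) + 20) * (bound n K r).+1 <= c * 2 ^ d * n ^ d * (R * minn (four_pow k) R).
    move=> lt; rewrite four_pow_budget -/K.
    apply: leq_trans (leq_mul Q_le (leqnn _)); rewrite /Q [leqRHS]mulnDl; apply: leq_add.
      by rewrite leq_pmulr // muln_gt0 leq_min expn_gt0 andbC (leq_trans _ lt).
    by rewrite -mulnA leq_mul2l bound_width ?orbT.
  (* If R outputs exist, each of them has fewer than R predecessors; otherwise the run halts with
     fewer than R outputs. Either way [Tle] applies, and R = 0 falls under the first case. *)
  move=> R B; case: (leqP R (size o)) => [leR|ltR]; [left|right]; last first.
    apply: leq_trans te _; apply: Tle; rewrite cat0s -(size_map (@enc_set n)) -Eo size_map.
    exact: ltR.
  rewrite /output_by size_filter -(cat_take_drop R o) count_cat.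
  apply: leq_trans (leq_addr _ _); rewrite -{1}(size_takel leR).
  have /eqP-> // : count (fun w => w.1 <= B) (take R o) == size (take R o).
  rewrite -all_count; apply/(all_nthP (0, Nil)) => i; rewrite size_takel // => lti.
  rewrite nth_take //; apply: leq_trans (tm i _) (Tle i R lti).
  exact: leq_trans lti leR.
Qed.
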